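(* Let $(\Omega,\mathcal A,\mu)$ be a $\sigma$-finite measure space, let $T\in DS$, and let $\{\beta_k\}_{k\ge0}$ be a bounded Besicovitch sequence. Then, given $f\in\mathcal R_\mu$, the averages \[ B_n(T)(f)=\frac1n\sum_{k=0}^{n-1}\beta_kT^k(f) \] converge almost uniformly to some $\widehat f\in\mathcal R_\mu$.
   Context: $\mathcal L^0$ is the space of a.e. equivalence classes of a.e. finite complex-valued measurable functions on $\Omega$, and $\mathcal L^p=\mathcal L^p(\Omega,\mu)$. $T\in DS$ (Dunford-Schwartz operator) means that $T:\mathcal L^1+\mathcal L^\infty\to\mathcal L^1+\mathcal L^\infty$ is linear with $\|T(f)\|_1\le\|f\|_1$ for all $f\in\mathcal L^1$ and $\|T(f)\|_\infty\le\|f\|_\infty$ for all $f\in\mathcal L^\infty$. $\mathcal R_\mu=\{f\in\mathcal L^1+\mathcal L^\infty:\ \mu\{|f|>\lambda\}<\infty\text{ for all }\lambda>0\}$. A sequence $\{f_n\}\subset\mathcal L^0$ converges almost uniformly (a.u.) to $f\in\mathcal L^0$ if for every $\varepsilon>0$ there is a measurable $G\subset\Omega$ with $\mu(\Omega\setminus G)\le\varepsilon$ and $\|(f-f_n)\chi_G\|_\infty\to0$. With $\mathbb C_1=\{z\in\mathbb C:|z|=1\}$, a trigonometric polynomial is a function $P:\mathbb Z\to\mathbb C$ of the form $P(k)=\sum_{j=1}^s z_j\lambda_j^k$ with $s\in\mathbb N$, $z_j\in\mathbb C$, $\lambda_j\in\mathbb C_1$. A sequence $\{\beta_k\}_{k\ge0}\subset\mathbb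 C$ is a bounded Besicovitch sequence if (i) $|\beta_k|\le C$ for all $k$ and some $C<\infty$; (ii) for every $\varepsilon>0$ there is a trigonometric polynomial $P$ with $\limsup_n\frac1n\sum_{k=0}^{n-1}|\beta_k-P(k)|<\varepsilon$. *)

(* Defs.v *)
From HB Require Import structures.
From mathcomp Require Import all_boot all_order all_algebra.
From mathcomp Require Import all_classical all_reals all_analysis.
From mathcomp Require Export complex.

Set Implicit Arguments.
Unset Strict Implicit.
Unset Printing Implicit Defensive.
Import Order.TTheory GRing.Theory Num.Theory.
Import numFieldNormedType.Exports.

Local Open Scope classical_set_scope.
Local Open Scope ring_scope.

(* The norm `|z| of R[i] takes its values in R[i]; this one is real-valued. *)
Definition cmod (R : realType) (z : R[i]) : R := ComplexField.Normc.normc z.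

(* Elements of L^0 are handled through everywhere defined representatives     *)
(* f : Omega -> R[i], equality of classes being ae_eq mu setT.                *)
Definition cmeasurable d (Omega : measurableType d) (R : realType)
    (f : Omega -> R[i]) : Prop :=
  measurable_fun setT (fun x => complex.Re (f x)) /\
  measurable_fun setT (fun x => complex.Im (f x)).

Section spaces.
Context d (Omega : measurableType d) (R : realType).
Variable mu : {measure set Omega -> \bar R}.

Definition cLnorm (p : \bar R) (f : Omega -> R[i]) : \bar R :=
  'N[mu]_p [EFin \o (@cmod R \o f)]%E.

Definition cLp (p : \bar R) : set (Omega -> R[i]) :=
  [set f | cmeasurable f /\ (cLnorm p f < +oo)%E].

(* The decomposition is required pointwise: an equality almost everywhere     *)
(* becomes pointwise by changing the L^1 summand on a null set.               *)
Definition L1_plus_Loo : set (Omega -> R[i]) :=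
  [set f | exists g h, [/\ cLp 1%E g, cLp +oo%E h & f = (fun x => g x + h x)]].

Definition Rmu : set (Omega -> R[i]) :=
  [set f | L1_plus_Loo f /\
    forall lambda : R, 0 < lambda ->
      (mu [set x | (lambda < cmod (f x))%R] < +oo)%E].

(* T acts on representatives; the first two fields say that it induces a map  *)
(* of L^1 + L^oo into itself. Values of T outside L^1 + L^oo are irrelevant.  *)
Record dunford_schwartz (T : (Omega -> R[i]) -> (Omega -> R[i])) : Prop := {
  ds_stable : forall f, L1_plus_Loo f -> L1_plus_Loo (T f) ;
  ds_ae_eq : forall f g, L1_plus_Loo f -> L1_plus_Loo g ->
    ae_eq mu setT f g -> ae_eq mu setT (T f) (T g) ;
  ds_linear : forall (a : R[i]) f g, L1_plus_Loo f -> L1_plus_Loo g ->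
    ae_eq mu setT (T (fun x => a * f x + g x)) (fun x => a * T f x + T g x) ;
  ds_L1 : forall f, cLp 1%E f -> (cLnorm 1%E (T f) <= cLnorm 1%E f)%E ;
  ds_Loo : forall f, cLp +oo%E f -> (cLnorm +oo%E (T f) <= cLnorm +oo%E f)%E
}.

Definition au_cvg (f_ : nat -> Omega -> R[i]) (f : Omega -> R[i]) : Prop :=
  forall eps : R, 0 < eps ->
    exists G : set Omega, [/\ measurable G, (mu (~` G) <= eps%:E)%E &
      (fun n => cLnorm +oo%E (fun x => (f x - f_ n x) * \1_G x)) @ \oo
        --> 0%E].

End spaces.

Definition trig_poly (R : realType) (P : int -> R[i]) : Prop :=
  exists (s : nat) (z lambda : 'I_s -> R[i]),
    (forall j, cmod (lambda j) = 1) /\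
    forall k : int, P k = \sum_(j < s) z j * lambda j ^ k.

Definition bounded_besicovitch (R : realType) (beta : nat -> R[i]) : Prop :=
  (exists C : R, forall k, cmod (beta k) <= C) /\
  forall eps : R, 0 < eps -> exists P : int -> R[i],
    trig_poly P /\
    (limn_esup (fun n : nat =>
       (n%:R^-1 * \sum_(k < n) cmod (beta k - P k%:Z))%:E) < eps%:E)%E.

(* B_n(T)(f); the value at n = 0 is 0. *)
Definition weighted_avg (Omega : Type) (R : realType) (beta : nat -> R[i])
    (T : (Omega -> R[i]) -> (Omega -> R[i])) (f : Omega -> R[i]) (n : nat) :
    Omega -> R[i] :=
  fun x => n%:R^-1 * \sum_(k < n) beta k * iter k T f x.

(* Main.v *)
Require Import Defs.
From HB Require Import structures.
From mathcomp Require Import all_boot all_order all_algebra.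
From mathcomp Require Import all_classical all_reals all_analysis.
From mathcomp Require Import measurable_realfun ess_sup_inf.
From mathcomp Require Import ring lra.

(** The proof reduces the theorem to one maximal inequality and to one class of
    functions on which the averages are understood.

    The maximal inequality [weak_type11] bounds the measure of the set where some
    average of the moduli of [iter k T f] exceeds [lam] by the [L^1] norm of [f]
    divided by [lam]. It is proved for complex [T] without a positive operator
    dominating it. In the filling scheme [fill] the function [f] is moved by [T],
    and at each point and time as much of the arriving mass is absorbed as a total
    capacity [lam] at that point allows. Where the capacity is not used up nothing
    is ever left over, so there [iter k T f] is a sum of images of absorbed parts.
    The moduli of the absorbed parts sum to at most [lam], and the [L^oo]
    contraction preserves this bound ([ds_sum_cmod]), so the averages are at most
    [lam]. Where the capacity is used up, [lam] has been absorbed, and the total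
    absorbed mass is at most the norm of [f].

    Let now [f] be in both [L^1] and [L^oo]. Slicing [f] by the size of its modulus
    shows that [T] contracts the square mean ([ds_L2n]), with no interpolation
    theorem. For a Dunford-Schwartz operator [S], look for the element of least
    square mean in the class of functions that differ from [f] by a coboundary
    [v - S v] with [v] bounded. By the parallelogram identity near minimisers are
    close to each other and to their averages, and the weak type (2,2) inequality
    turns this into closeness off a set of small measure, uniformly in the length
    of the average. Coboundaries contribute averages that tend to 0 uniformly.
    Hence the averages of [f] are, up to any error, almost uniformly constant in
    the length ([mean_ergodic]). The operators [S = lambda T] with [lambda] of
    modulus 1 give the weights [lambda ^+ k], and linear combinations give
    trigonometric polynomials. Besicovitch weights are approximated in the mean by
    these, at a cost proportional to the bound of [f] ([au_cauchy_L1Loo]).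

    The maximal inequality extends the result to [L^1], and a function of [Rmu] is
    uniformly close to one of [L^1] ([Rmu_split]). The convergence is expressed
    throughout by [au_close]; the limit itself is constructed once, in
    [au_cauchy_limit], and lies in [Rmu] by Fatou's lemma ([limit_Rmu]). *)

Set Implicit Arguments.
Unset Strict Implicit.
Unset Printing Implicit Defensive.
Import Order.TTheory GRing.Theory Num.Theory.
Import numFieldNormedType.Exports.

Local Open Scope classical_set_scope.
Local Open Scope ring_scope.

(** * The modulus of complex numbers *)

Arguments cmod : simpl never.

Section modulus.
Context {R : realType}.
Implicit Types (z w : R[i]) (c : R).

Lemma cmodE z : cmod z = Num.sqrt (complex.Re z ^+ 2 + complex.Im z ^+ 2).
Proof. by case: z. Qed.

Lemma cmodEnorm z : `|z| = (cmod z)%:C%C.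
Proof. by []. Qed.

Lemma cmod_ge0 z : 0 <= cmod z.
Proof. by rewrite cmodE sqrtr_ge0. Qed.

Lemma cmod0 : cmod (0 : R[i]) = 0.
Proof. exact: ComplexField.Normc.normc0. Qed.

Lemma cmodM z w : cmod (z * w) = cmod z * cmod w.
Proof. exact: ComplexField.Normc.normcM. Qed.

Lemma cmodV z : cmod z^-1 = (cmod z)^-1.
Proof. exact: ComplexField.Normc.normcV. Qed.

Lemma cmod_eq0 z : cmod z = 0 -> z = 0.
Proof. exact: ComplexField.Normc.eq0_normc. Qed.

Lemma cmodD z w : cmod (z + w) <= cmod z + cmod w.
Proof. by have := ler_normD z w; rewrite !cmodEnorm -rmorphD/= lecR. Qed.

Lemma cmodN z : cmod (- z) = cmod z.
Proof. by rewrite !cmodE; case: z => a b /=; rewrite !sqrrN. Qed.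

Lemma cmodBC z w : cmod (z - w) = cmod (w - z).
Proof. by rewrite -cmodN opprB. Qed.

Lemma cmodB z w : cmod (z - w) <= cmod z + cmod w.
Proof. by rewrite -(cmodN w) cmodD. Qed.

Lemma cmod_dist z w : `|cmod z - cmod w| <= cmod (w - z).
Proof.
have := cmodD (w - z) z; have := cmodD (z - w) w.
rewrite !subrK (cmodBC z) ler_norml => h1 h2.
by apply/andP; split; lra.
Qed.

Lemma cmod_sum I (s : seq I) (P : pred I) (F : I -> R[i]) :
  cmod (\sum_(i <- s | P i) F i) <= \sum_(i <- s | P i) cmod (F i).
Proof.
elim/big_ind2 : _ => [|z a w b za wb|//]; first by rewrite cmod0.
by rewrite (le_trans (cmodD _ _))// lerD.
Qed.

Lemma cmodR c : cmod c%:C%C = `|c|.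
Proof. by rewrite cmodE /= expr0n addr0 sqrtr_sqr. Qed.

Lemma cmod_nat n : cmod (n%:R : R[i]) = n%:R.
Proof. by rewrite -(rmorph_nat (real_complex R)) cmodR ger0_norm. Qed.

Lemma Re_le_cmod z : complex.Re z <= cmod z.
Proof.
rewrite cmodE (le_trans (ler_norm _))// -sqrtr_sqr ler_wsqrtr//.
by rewrite lerDl sqr_ge0.
Qed.

Lemma normRe_le_cmod z : `|complex.Re z| <= cmod z.
Proof. by rewrite cmodE -sqrtr_sqr ler_wsqrtr// lerDl sqr_ge0. Qed.

Lemma normIm_le_cmod z : `|complex.Im z| <= cmod z.
Proof. by rewrite cmodE -sqrtr_sqr ler_wsqrtr// lerDr sqr_ge0. Qed.

Lemma cmod_le_ReIm z : cmod z <= `|complex.Re z| + `|complex.Im z|.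
Proof.
case: z => a b /=.
have -> : Complex a b = a%:C%C + Complex 0 b.
  by apply/eqP; rewrite eq_complex /= addr0 add0r !eqxx.
rewrite (le_trans (cmodD _ _))// cmodR lerD2l.
by rewrite cmodE /= expr0n add0r sqrtr_sqr.
Qed.

Lemma cmod_parallelogram z w :
  cmod (z - w) ^+ 2 = 2 * cmod z ^+ 2 + 2 * cmod w ^+ 2
                      - 4 * cmod (2^-1 * (z + w)) ^+ 2.
Proof.
rewrite cmodM cmodV (cmod_nat 2) exprMn !cmodE !sqr_sqrtr ?addr_ge0 ?sqr_ge0//.
by case: z w => a b [a' b'] /=; field.
Qed.

(** A rational phase of modulus at most 1 that nearly rotates [z] onto the
    positive axis; there are countably many of them, so that an almost
    everywhere statement can be made for all of them at once. *)
Definition phase (p : rat * rat) : R[i] := Complex (ratr p.1) (ratr p.2).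

(** The product form of the approximation, with no division by [t], also covers
    [t = 0]; keeping the modulus of the rational below that of [t] is what keeps
    the phases built from it inside the unit disc. *)
Lemma rat_between0 (t eta : R) : 0 < eta ->
  exists q : rat, `|ratr q : R| <= `|t| /\ t ^+ 2 - eta * `|t| <= ratr q * t.
Proof.
move=> eta0.
wlog t0 : t / 0 < t => [H|].
  have [t0|/H//|->] := ltgtP t 0; last first.
    by exists 0%R; rewrite rmorph0 normr0 expr0n !mulr0 subrr.
  have [|q [q1 q2]] := H (- t); first by rewrite oppr_gt0.
  by exists (- q)%R; move: q1 q2; rewrite rmorphN !normrN sqrrN mulrN mulNr; split.
have [|q /itvP qt] := @rat_in_itvoo R (Num.max 0 (t - eta)) t.
  by rewrite gt_max t0 gtrBl.
exists q; have q0 : 0 < ratr q :> R.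
  by rewrite (le_lt_trans _ (_ : Num.max 0 (t - eta) < _)) ?le_max ?lexx// qt.
have qe : t - eta <= ratr q.
  by rewrite (le_trans _ (ltW (_ : Num.max 0 (t - eta) < _))) ?le_max ?lexx ?orbT// qt.
rewrite !gtr0_norm//; split; first by rewrite ltW// qt.
by rewrite expr2 -mulrBl ler_pM2r.
Qed.

Lemma phase_approx z (eta : R) : 0 < eta ->
  exists p, cmod (phase p) <= 1 /\ cmod z - eta <= complex.Re (phase p * z).
Proof.
move=> eta0.
have [z0|z0] := eqVneq (cmod z) 0.
  exists (0%R, 0%R); rewrite z0 /phase /= rmorph0 cmod0; split=> //.
  by case: z z0 => a b /cmod_eq0 -> /=; rewrite !mulr0 subr0 sub0r oppr_le0 ltW.
have r0 : 0 < cmod z by rewrite lt_neqAle eq_sym z0 cmod_ge0.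
case: z r0 z0 => a b; set r := cmod _ => r0 z0.
have rr : a ^+ 2 + b ^+ 2 = r ^+ 2.
  by rewrite /r cmodE sqr_sqrtr// addr_ge0 ?sqr_ge0.
have e2 : 0 < eta / 2 / r by rewrite !divr_gt0.
have [p [p1 p2]] := rat_between0 (a / r) e2.
have [q [q1 q2]] := rat_between0 (b / r) e2.
have ar : `|a / r| <= 1.
  by rewrite normrM normfV (gtr0_norm r0) ler_pdivrMr// mul1r (normRe_le_cmod (Complex a b)).
have br : `|b / r| <= 1.
  by rewrite normrM normfV (gtr0_norm r0) ler_pdivrMr// mul1r (normIm_le_cmod (Complex a b)).
have sq : (a / r) ^+ 2 + (b / r) ^+ 2 = 1.
  by rewrite !exprMn -mulrDl rr -exprMn divff// expr1n.
(* the phase approximates the conjugate of z / |z| *)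
exists (p, - q)%R; split.
  rewrite cmodE /= -(sqrtr1 R) ler_wsqrtr// rmorphN sqrrN -sq lerD//.
    by rewrite -(real_normK (num_real (ratr p))) -(real_normK (num_real (a / r))) lerXn2r ?nnegrE.
  by rewrite -(real_normK (num_real (ratr q))) -(real_normK (num_real (b / r))) lerXn2r ?nnegrE.
rewrite /phase /= rmorphN mulNr opprK.
have pa : (a / r) ^+ 2 - eta / 2 / r <= ratr p * (a / r).
  by apply: le_trans p2; rewrite lerB// ler_piMr// ltW.
have qb : (b / r) ^+ 2 - eta / 2 / r <= ratr q * (b / r).
  by apply: le_trans q2; rewrite lerB// ler_piMr// ltW.
have := lerD pa qb; rewrite addrACA sq.
have -> : ratr p * (a / r) + ratr q * (b / r) = (ratr p * a + ratr q * b) / r.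
  by rewrite mulrDl !mulrA.
rewrite ler_pdivlMr//; apply: le_trans.
by rewrite le_eqVlt; apply/orP; left; apply/eqP; field.
Qed.

Lemma ReD z w : complex.Re (z + w) = complex.Re z + complex.Re w.
Proof. by case: z w => ? ? []. Qed.

Lemma ImD z w : complex.Im (z + w) = complex.Im z + complex.Im w.
Proof. by case: z w => ? ? []. Qed.

Lemma Re_sum n (z : 'I_n -> R[i]) :
  complex.Re (\sum_i z i) = \sum_i complex.Re (z i).
Proof. by apply: (big_morph (@complex.Re R)) => //; exact: ReD. Qed.

(** Rotating every summand nearly onto the positive axis makes the modulus of the
    sum nearly the sum of the moduli. *)
Lemma sum_cmod_phase n (z : 'I_n -> R[i]) c :
  (forall p : {ffun 'I_n -> rat * rat}, (forall i, cmod (phase (p i)) <= 1) ->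
     cmod (\sum_i phase (p i) * z i) <= c) ->
  \sum_i cmod (z i) <= c.
Proof.
move=> H; apply/ler_addgt0Pr => e e0.
have e1 : 0 < e / n.+1%:R by rewrite divr_gt0.
pose p := [ffun i => projT1 (cid (phase_approx (z i) e1))].
have pP i : cmod (phase (p i)) <= 1 /\
    cmod (z i) - e / n.+1%:R <= complex.Re (phase (p i) * z i).
  by rewrite /p ffunE; case: cid.
have := H p (fun i => (pP i).1); rewrite -lerBlDr; apply: le_trans.
apply: le_trans (Re_le_cmod _); rewrite Re_sum.
apply: (@le_trans _ _ (\sum_i (cmod (z i) - e / n.+1%:R))); last first.
  by apply: ler_sum => i _; exact: (pP i).2.
rewrite sumrB lerB// sumr_const card_ord -[leLHS]mulr_natr mulrAC.
by rewrite ler_pdivrMr// ler_pM2l// ler_nat.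
Qed.

End modulus.

(** * Measurable complex functions and integrals of nonnegative functions *)

Section measurability.
Context d (Omega : measurableType d) (R : realType).
Implicit Types f g : Omega -> R[i].

Lemma cmeas_cmod f : cmeasurable f -> measurable_fun setT (fun x => cmod (f x)).
Proof.
move=> [mr mi].
have -> : (fun x => cmod (f x)) =
    Num.sqrt \o (fun x => complex.Re (f x) ^+ 2 + complex.Im (f x) ^+ 2).
  by apply/funext => x /=; rewrite cmodE.
apply: measurableT_comp; first by apply: continuous_measurable_fun; exact: sqrt_continuous.
by apply: measurable_funD; apply: measurable_funX.
Qed.

Lemma cmeas_cst z : cmeasurable (fun _ : Omega => z : R[i]).
Proof. by split; exact: measurable_cst. Qed.

Lemma cmeasD f g : cmeasurable f -> cmeasurable g -> cmeasurable (fun x => f x + g x).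
Proof.
move=> [fr fi] [gr gi]; split.
  by under eq_fun do rewrite ReD; exact: measurable_funD.
by under eq_fun do rewrite ImD; exact: measurable_funD.
Qed.

Lemma cmeasM f g : cmeasurable f -> cmeasurable g -> cmeasurable (fun x => f x * g x).
Proof.
move=> [fr fi] [gr gi]; split.
  have -> : (fun x => complex.Re (f x * g x)) = (fun x =>
      complex.Re (f x) * complex.Re (g x) - complex.Im (f x) * complex.Im (g x)).
    by apply/funext => x; case: (f x) (g x) => ? ? [].
  by apply: measurable_funB; exact: measurable_funM.
have -> : (fun x => complex.Im (f x * g x)) = (fun x =>
    complex.Re (f x) * complex.Im (g x) + complex.Im (f x) * complex.Re (g x)).
  by apply/funext => x; case: (f x) (g x) => ? ? [].
by apply: measurable_funD; exact: measurable_funM.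
Qed.

Lemma cmeasZ z f : cmeasurable f -> cmeasurable (fun x => z * f x).
Proof. exact: cmeasM (cmeas_cst z). Qed.

Lemma cmeasB f g : cmeasurable f -> cmeasurable g -> cmeasurable (fun x => f x - g x).
Proof.
move=> mf mg; under eq_fun do rewrite -(mulN1r (g _)).
by apply: cmeasD => //; exact: cmeasZ.
Qed.

Lemma cmeas_sum I (s : seq I) (F : I -> Omega -> R[i]) :
  (forall i, cmeasurable (F i)) -> cmeasurable (fun x => \sum_(i <- s) F i x).
Proof.
move=> mF; elim: s => [|i s IH].
  by under eq_fun do rewrite big_nil; exact: cmeas_cst.
by under eq_fun do rewrite big_cons; exact: cmeasD.
Qed.

Lemma cmeasR (u : Omega -> R) : measurable_fun setT u ->
  cmeasurable (fun x => (u x)%:C%C).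
Proof. by move=> mu; split => //=; exact: measurable_cst. Qed.

Lemma measurable_ltr_set (u v : Omega -> R) : measurable_fun setT u ->
  measurable_fun setT v -> measurable [set x | u x < v x].
Proof.
move=> mu mv; rewrite -[X in measurable X]setTI.
by have := measurable_fun_ltr mu mv => /(_ measurableT [set true]); apply.
Qed.

Lemma measurable_ler_set (u v : Omega -> R) : measurable_fun setT u ->
  measurable_fun setT v -> measurable [set x | u x <= v x].
Proof.
move=> mu mv; rewrite -[X in measurable X]setTI.
by have := measurable_fun_ler mu mv => /(_ measurableT [set true]); apply.
Qed.

End measurability.

Section integral.
Context d (Omega : measurableType d) (R : realType).
Variable mu : {measure set Omega -> \bar R}.
Implicit Types (u v : Omega -> R) (A B : set Omega) (c : R).

Definition nnegmf u := measurable_fun setT u /\ forall x, 0 <= u x.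

Definition integ u : \bar R := \int[mu]_x (u x)%:E.

Lemma integ_ge0 u : (forall x, 0 <= u x) -> (0 <= integ u)%E.
Proof. by move=> u0; apply: integral_ge0 => x _; rewrite lee_fin. Qed.

Lemma le_integ u v : nnegmf u -> nnegmf v ->
  (\forall x \ae mu, u x <= v x) -> (integ u <= integ v)%E.
Proof.
move=> [mu_meas u0] [mv v0] uv; apply: ae_ge0_le_integral => //.
- by move=> x _; rewrite lee_fin.
- exact/measurable_EFinP.
- by move=> x _; rewrite lee_fin.
- exact/measurable_EFinP.
- by apply: filterS uv => x + _; rewrite lee_fin.
Qed.

Lemma integD u v : nnegmf u -> nnegmf v ->
  (integ (fun x => (u x + v x)%R) = integ u + integ v)%E.
Proof.
move=> [mu_meas u0] [mv v0]; rewrite /integ.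
under eq_integral do rewrite EFinD.
rewrite ge0_integralD//.
- by move=> x _; rewrite lee_fin.
- exact/measurable_EFinP.
- by move=> x _; rewrite lee_fin.
- exact/measurable_EFinP.
Qed.

Lemma integZ c u : 0 <= c -> nnegmf u ->
  (integ (fun x => (c * u x)%R) = c%:E * integ u)%E.
Proof.
move=> c0 [mu_meas u0]; rewrite /integ.
under eq_integral do rewrite EFinM.
rewrite ge0_integralZl//.
- exact/measurable_EFinP.
- by move=> x _; rewrite lee_fin.
Qed.

Lemma integ_sum n (F : 'I_n -> Omega -> R) : (forall i, nnegmf (F i)) ->
  (integ (fun x => (\sum_(i < n) F i x)%R) = \sum_(i < n) integ (F i))%E.
Proof.
move=> HF; rewrite /integ.
under eq_integral do rewrite -sumEFin.
rewrite ge0_integral_sum//.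
- by move=> i; apply/measurable_EFinP; exact: (HF i).1.
- by move=> i x _; rewrite lee_fin; exact: (HF i).2.
Qed.

Lemma nnegmfD u v : nnegmf u -> nnegmf v -> nnegmf (fun x => u x + v x).
Proof.
move=> [mu_meas u0] [mv v0]; split; first exact: measurable_funD.
by move=> x; rewrite addr_ge0.
Qed.

Lemma nnegmfM u v : nnegmf u -> nnegmf v -> nnegmf (fun x => u x * v x).
Proof.
move=> [mu_meas u0] [mv v0]; split; first exact: measurable_funM.
by move=> x; rewrite mulr_ge0.
Qed.

Lemma nnegmf_cst c : 0 <= c -> nnegmf (cst c).
Proof. by move=> c0; split => //; exact: measurable_cst. Qed.

Lemma nnegmfZ c u : 0 <= c -> nnegmf u -> nnegmf (fun x => c * u x).
Proof. by move=> /nnegmf_cst; exact: nnegmfM. Qed.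

Lemma nnegmfX u n : nnegmf u -> nnegmf (fun x => u x ^+ n).
Proof.
move=> [mu_meas u0]; split; first exact: measurable_funX.
by move=> x; rewrite exprn_ge0.
Qed.

Lemma nnegmf_sum n (F : 'I_n -> Omega -> R) : (forall i, nnegmf (F i)) ->
  nnegmf (fun x => \sum_(i < n) F i x).
Proof.
move=> HF; split; last by move=> x; rewrite sumr_ge0// => i _; exact: (HF i).2.
by apply: measurable_sum => i; exact: (HF i).1.
Qed.

Lemma nnegmf_cmod f : cmeasurable f -> nnegmf (fun x => cmod (f x)).
Proof. by move=> mf; split=> [|x]; [exact: cmeas_cmod|exact: cmod_ge0]. Qed.

Lemma nnegmf_indic A : measurable A -> nnegmf (\1_A).
Proof. by move=> mA; split=> [|x]; [exact: measurable_indic|rewrite indicE ler0n]. Qed.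

Lemma integ_indic A : measurable A -> integ (\1_A) = mu A.
Proof. by move=> mA; rewrite /integ integral_indic// setIT. Qed.

Lemma markov_integ c u : 0 < c -> nnegmf u ->
  (c%:E * mu [set x | (c <= u x)%R] <= integ u)%E.
Proof.
move=> c0 [mu_meas u0].
have mA : measurable [set x | c <= u x].
  by apply: measurable_ler_set => //; exact: measurable_cst.
rewrite -(integ_indic mA) -(integZ (ltW c0) (nnegmf_indic mA)).
apply: le_integ => //.
  exact: (nnegmfZ (ltW c0) (nnegmf_indic mA)).
apply: aeW => x; rewrite indicE; case: (boolP (x \in _)) => [|_]; last by rewrite mulr0.
by rewrite inE /= mulr1.
Qed.

Lemma ae_le_mu A B : measurable A -> measurable B ->
  (\forall x \ae mu, A x -> B x) -> (mu A <= mu B)%E.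
Proof.
move=> mA mB AB; rewrite -!integ_indic//; apply: le_integ.
- exact: nnegmf_indic.
- exact: nnegmf_indic.
apply: filterS AB => x AB; rewrite !indicE ler_nat.
by case: (boolP (x \in A)) => //; rewrite inE => /AB /mem_set ->.
Qed.

Lemma leU_mu A B : measurable A -> measurable B -> (mu (A `|` B) <= mu A + mu B)%E.
Proof. by move=> mA mB; exact: measureU2. Qed.

Lemma nondecreasing_mu_le (A : nat -> set Omega) (c : \bar R) :
  (forall n, measurable (A n)) -> (forall n, A n `<=` A n.+1) ->
  (forall n, mu (A n) <= c)%E -> (mu (\bigcup_n A n) <= c)%E.
Proof.
move=> mA ndA Ac.
have cv : mu (A n) @[n --> \oo] --> mu (\bigcup_n A n).
  apply: nondecreasing_cvg_mu => //; first exact: bigcup_measurable.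
  by apply/nondecreasing_seqP => n; apply/subsetPset; exact: ndA.
rewrite -(cvg_lim _ cv)//; apply: lime_le; first by apply/cvg_ex; eexists; exact: cv.
exact: nearW.
Qed.

Lemma ae_countType (I : countType) (P : I -> Omega -> Prop) :
  (forall i, \forall x \ae mu, P i x) -> \forall x \ae mu, forall i, P i x.
Proof.
move=> HP.
have : \forall x \ae mu, forall n, if unpickle n is Some i then P i x else True.
  by apply/ae_foralln => n; case: unpickle => [i|]; [exact: HP|exact: aeW].
by apply: filterS => x Hx i; have := Hx (pickle i); rewrite pickleK.
Qed.

Lemma fatou_le (F : nat -> Omega -> R) u (c : \bar R) :
  (forall n, nnegmf (F n)) -> nnegmf u ->
  (\forall x \ae mu, F n x @[n --> \oo] --> u x) ->
  (forall n, integ (F n) <= c)%E -> (integ u <= c)%E.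
Proof.
move=> HF Hu cv Fc.
have mF n : measurable_fun setT (fun x => (F n x)%:E).
  by apply/measurable_EFinP; exact: (HF n).1.
have F0 n x : (setT : set Omega) x -> (0 <= (F n x)%:E)%E.
  by move=> _; rewrite lee_fin; exact: (HF n).2.
have := fatou mu measurableT mF F0; set L := (X in (X <= _)%E) => fat.
have mL : measurable_fun setT (fun x => limn_einf (fun n => (F n x)%:E)).
  rewrite (_ : (fun _ => _) =
      (fun x => - limn_esup (fun n => (- F n x)%:E))%E); last first.
    by apply/funext => x; rewrite /limn_einf; congr (- limn_esup _)%E.
  apply: measurableT_comp => //; apply: measurable_fun_limn_esup => n.
  by apply/measurable_EFinP/measurable_funN; exact: (HF n).1.
have LE : L = integ u.
  rewrite /L /integ; apply: ge0_ae_eq_integral => //.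
  - by apply/measurable_EFinP; exact: Hu.1.
  - move=> x _; rewrite limn_einf_lim; apply: lime_ge; first exact: is_cvg_einfs.
    apply: nearW => n; apply: le_ereal_inf_tmp => _ [k _ <-]; exact: F0.
  - by move=> x _; rewrite lee_fin; exact: Hu.2.
  apply: filterS cv => x cv _.
  have h : (F n x)%:E @[n --> \oo] --> (u x)%:E by apply/cvg_EFin => //; exact: nearW.
  exact: (cvg_limn_einf_sup h).1.
rewrite -LE; apply: le_trans fat _; rewrite limn_einf_lim.
apply: lime_le; first exact: is_cvg_einfs.
by apply: nearW => n; apply: le_trans (Fc n); apply: ereal_inf_lbound; exists n => /=.
Qed.

End integral.

(** * Dunford-Schwartz operators on representatives *)

Section spaces.
Context d (Omega : measurableType d) (R : realType).
Variable mu : {measure set Omega -> \bar R}.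
Implicit Types (f g : Omega -> R[i]) (c : R).

Definition L1n f : \bar R := integ mu (fun x => cmod (f x)).

Lemma cLnorm1E f : cLnorm mu 1%E f = L1n f.
Proof.
rewrite /cLnorm Lnorm1; apply: eq_integral => x _ /=.
by rewrite ger0_norm// cmod_ge0.
Qed.

(** For the zero measure the norm is 0 by convention while every almost everywhere
    bound holds, whence the condition on [c]. *)
Lemma cLnormooP c f : 0 <= c ->
  (cLnorm mu +oo%E f <= c%:E)%E <-> \forall x \ae mu, cmod (f x) <= c.
Proof.
move=> c0; rewrite /cLnorm unlock.
have -> : abse \o (EFin \o (@cmod R \o f)) = (fun x => (cmod (f x))%:E).
  by apply/funext => x /=; rewrite ger0_norm// cmod_ge0.
case: ifPn => [mu0|].
  split; first by move/ess_supP; apply: filterS => x; rewrite lee_fin.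
  by move=> h; apply/ess_supP; apply: filterS h => x; rewrite lee_fin.
rewrite -leNgt => mu0; split=> [_|_]; last by rewrite lee_fin.
exists setT; split=> //; apply/eqP; rewrite eq_le mu0/=; exact: measure_ge0.
Qed.

Lemma cLp1P f : cLp mu 1%E f <-> cmeasurable f /\ (L1n f < +oo)%E.
Proof. by rewrite /cLp /= cLnorm1E. Qed.

Lemma cLpooP f : cLp mu +oo%E f <->
  cmeasurable f /\ exists c, 0 <= c /\ \forall x \ae mu, cmod (f x) <= c.
Proof.
split=> [[mf fb]|[mf [c [c0 fc]]]]; split=> //; last first.
  by apply: le_lt_trans (ltry c); apply/cLnormooP.
have f0 : (0 <= cLnorm mu +oo%E f)%E by exact: Lnorm_ge0.
exists (fine (cLnorm mu +oo%E f)); split; first exact: fine_ge0.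
by apply/cLnormooP; [exact: fine_ge0|rewrite fineK// ge0_fin_numE].
Qed.

Definition L1Loo f := [/\ cmeasurable f, (L1n f < +oo)%E &
  exists c, 0 <= c /\ \forall x \ae mu, cmod (f x) <= c].

Lemma L1Loo_L1 f : L1Loo f -> cLp mu 1%E f.
Proof. by case=> mf f1 _; apply/cLp1P. Qed.

Lemma L1Loo_Loo f : L1Loo f -> cLp mu +oo%E f.
Proof. by case=> mf _ fb; apply/cLpooP. Qed.

Lemma L1LooP f : L1Loo f <-> cLp mu 1%E f /\ cLp mu +oo%E f.
Proof.
split=> [vf|[/cLp1P[mf f1] /cLpooP[_ fb]]]; last by [].
by split; [exact: L1Loo_L1|exact: L1Loo_Loo].
Qed.

Lemma L1n_ge0 f : (0 <= L1n f)%E.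
Proof. by apply: integ_ge0 => x; exact: cmod_ge0. Qed.

Lemma cLp1_le f g : cmeasurable f -> cLp mu 1%E g ->
  (\forall x \ae mu, cmod (f x) <= cmod (g x)) -> cLp mu 1%E f.
Proof.
move=> mf /cLp1P[mg g1] fg; apply/cLp1P; split=> //.
by apply: le_lt_trans g1; apply: le_integ => //; exact: nnegmf_cmod.
Qed.

Lemma cLp1D a f g : cLp mu 1%E f -> cLp mu 1%E g ->
  cLp mu 1%E (fun x => a * f x + g x).
Proof.
move=> /cLp1P[mf f1] /cLp1P[mg g1]; apply/cLp1P; split.
  by apply: cmeasD => //; exact: cmeasZ.
have nf := nnegmf_cmod mf; have ng := nnegmf_cmod mg.
apply: (@le_lt_trans _ _ (integ mu (fun x => cmod a * cmod (f x) + cmod (g x)))).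
  apply: le_integ; first by apply: nnegmf_cmod; apply: cmeasD => //; exact: cmeasZ.
    by apply: nnegmfD => //; apply: nnegmfZ => //; exact: cmod_ge0.
  by apply: aeW => x; rewrite -cmodM cmodD.
rewrite integD//; last by apply: nnegmfZ => //; exact: cmod_ge0.
rewrite integZ//; last exact: cmod_ge0.
by apply: lte_add_pinfty => //; apply: lte_mul_pinfty => //; rewrite lee_fin cmod_ge0.
Qed.

Lemma cLpooD a f g : cLp mu +oo%E f -> cLp mu +oo%E g ->
  cLp mu +oo%E (fun x => a * f x + g x).
Proof.
move=> /cLpooP[mf [c [c0 fc]]] /cLpooP[mg [e [e0 ge]]]; apply/cLpooP; split.
  by apply: cmeasD => //; exact: cmeasZ.
exists (cmod a * c + e); split; first by rewrite addr_ge0// mulr_ge0// cmod_ge0.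
apply: filterS2 fc ge => x fc ge; rewrite (le_trans (cmodD _ _))//.
by rewrite lerD// cmodM ler_wpM2l// cmod_ge0.
Qed.

Lemma L1LooD a f g : L1Loo f -> L1Loo g -> L1Loo (fun x => a * f x + g x).
Proof.
move=> /L1LooP[f1 f2] /L1LooP[g1 g2]; apply/L1LooP.
by split; [exact: cLp1D|exact: cLpooD].
Qed.

Lemma cLp10 : cLp mu 1%E (fun=> 0 : R[i]).
Proof.
apply/cLp1P; split; first exact: cmeas_cst.
rewrite /L1n /integ integral0_eq// => x _; by rewrite cmod0.
Qed.

Lemma cLpoo0 : cLp mu +oo%E (fun=> 0 : R[i]).
Proof.
apply/cLpooP; split; first exact: cmeas_cst.
by exists 0; split => //; apply: aeW => x; rewrite cmod0.
Qed.

Lemma L1Loo0 : L1Loo (fun=> 0 : R[i]).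
Proof. by apply/L1LooP; split; [exact: cLp10|exact: cLpoo0]. Qed.

Lemma L1LooZ a f : L1Loo f -> L1Loo (fun x => a * f x).
Proof. by move=> /(L1LooD a) /(_ L1Loo0); under eq_fun do rewrite addr0. Qed.

Lemma L1LooB f g : L1Loo f -> L1Loo g -> L1Loo (fun x => f x - g x).
Proof.
move=> vf vg; have := L1LooD (-1) vg vf.
by under eq_fun do rewrite mulN1r addrC.
Qed.

Lemma L1LooDD f g : L1Loo f -> L1Loo g -> L1Loo (fun x => f x + g x).
Proof. by move=> vf vg; have := L1LooD 1 vf vg; under eq_fun do rewrite mul1r. Qed.

Lemma L1Loo_sum n (F : 'I_n -> Omega -> R[i]) :
  (forall i, L1Loo (F i)) -> L1Loo (fun x => \sum_i F i x).
Proof.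
elim: n F => [|n IH] F HF; first by under eq_fun do rewrite big_ord0; exact: L1Loo0.
under eq_fun do rewrite big_ord_recl.
by apply: L1LooDD => //; apply: IH.
Qed.

Lemma L1Loo_le f g : cmeasurable f -> L1Loo g ->
  (\forall x \ae mu, cmod (f x) <= cmod (g x)) -> L1Loo f.
Proof.
move=> mf [mg g1 [c [c0 gc]]] fg; split=> //.
  by have /cLp1P[] : cLp mu 1%E f by apply: (cLp1_le mf _ fg); apply/cLp1P.
by exists c; split=> //; apply: filterS2 fg gc => x; exact: le_trans.
Qed.

Lemma L1_Lsum f : cLp mu 1%E f -> L1_plus_Loo mu f.
Proof.
move=> f1; exists f, (fun=> 0); split=> //; first exact: cLpoo0.
by apply/funext => x; rewrite addr0.
Qed.

Lemma Loo_Lsum f : cLp mu +oo%E f -> L1_plus_Loo mu f.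
Proof.
move=> f1; exists (fun=> 0), f; split=> //; first exact: cLp10.
by apply/funext => x; rewrite add0r.
Qed.

Lemma L1Loo_Lsum f : L1Loo f -> L1_plus_Loo mu f.
Proof. by move/L1Loo_L1/L1_Lsum. Qed.

Lemma Lsum_meas f : L1_plus_Loo mu f -> cmeasurable f.
Proof. by move=> [g [h [[mg _] [mh _] ->]]]; exact: cmeasD. Qed.

Lemma LsumD a f g : L1_plus_Loo mu f -> L1_plus_Loo mu g ->
  L1_plus_Loo mu (fun x => a * f x + g x).
Proof.
move=> [f1 [f2 [h1 h2 ->]]] [g1 [g2 [k1 k2 ->]]].
exists (fun x => a * f1 x + g1 x), (fun x => a * f2 x + g2 x).
split; [exact: cLp1D|exact: cLpooD|].
by apply/funext => x; rewrite mulrDr addrACA.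
Qed.

Lemma Lsum0 : L1_plus_Loo mu (fun=> 0 : R[i]).
Proof. exact: (L1Loo_Lsum L1Loo0). Qed.

Lemma LsumZ a f : L1_plus_Loo mu f -> L1_plus_Loo mu (fun x => a * f x).
Proof. by move=> /(LsumD a) /(_ Lsum0); under eq_fun do rewrite addr0. Qed.

Lemma LsumDD f g : L1_plus_Loo mu f -> L1_plus_Loo mu g ->
  L1_plus_Loo mu (fun x => f x + g x).
Proof. by move=> vf vg; have := LsumD 1 vf vg; under eq_fun do rewrite mul1r. Qed.

Lemma Lsum_sum n (F : 'I_n -> Omega -> R[i]) :
  (forall i, L1_plus_Loo mu (F i)) -> L1_plus_Loo mu (fun x => \sum_i F i x).
Proof.
elim: n F => [|n IH] F HF; first by under eq_fun do rewrite big_ord0; exact: Lsum0.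
under eq_fun do rewrite big_ord_recl.
by apply: LsumDD => //; apply: IH.
Qed.

Section operator.
Variable T : (Omega -> R[i]) -> Omega -> R[i].
Hypothesis hT : dunford_schwartz mu T.

Lemma ds_cLp1 f : cLp mu 1%E f -> cLp mu 1%E (T f).
Proof.
move=> f1; have mTf := Lsum_meas (ds_stable hT (L1_Lsum f1)).
by split=> //; apply: le_lt_trans (ds_L1 hT f1) _; case: f1.
Qed.

Lemma ds_L1n f : cLp mu 1%E f -> (L1n (T f) <= L1n f)%E.
Proof. by move=> f1; rewrite -!cLnorm1E; exact: ds_L1. Qed.

Lemma ds_cLpoo f : cLp mu +oo%E f -> cLp mu +oo%E (T f).
Proof.
move=> f1; have mTf := Lsum_meas (ds_stable hT (Loo_Lsum f1)).
by split=> //; apply: le_lt_trans (ds_Loo hT f1) _; case: f1.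
Qed.

Lemma ds_bnd c f : 0 <= c -> cmeasurable f ->
  (\forall x \ae mu, cmod (f x) <= c) -> \forall x \ae mu, cmod (T f x) <= c.
Proof.
move=> c0 mf fc; have fP : cLp mu +oo%E f by apply/cLpooP; split=> //; exists c.
apply/cLnormooP => //; apply: le_trans (ds_Loo hT fP) _.
exact/cLnormooP.
Qed.

Lemma ds_L1Loo f : L1Loo f -> L1Loo (T f).
Proof. by move=> /L1LooP[f1 f2]; apply/L1LooP; split; [exact: ds_cLp1|exact: ds_cLpoo]. Qed.

Lemma ds_eq f g : L1_plus_Loo mu f -> L1_plus_Loo mu g ->
  (\forall x \ae mu, f x = g x) -> \forall x \ae mu, T f x = T g x.
Proof.
move=> xf xg fg; have : ae_eq mu setT f g by apply: filterS fg.
by move/(ds_ae_eq hT xf xg); apply: filterS => x; exact.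
Qed.

Lemma ds_lin a f g : L1_plus_Loo mu f -> L1_plus_Loo mu g ->
  \forall x \ae mu, T (fun x => a * f x + g x) x = a * T f x + T g x.
Proof.
by move=> xf xg; apply: filterS (ds_linear hT a xf xg) => x; exact.
Qed.

Lemma ds0 : \forall x \ae mu, T (fun=> 0) x = 0.
Proof.
have := ds_lin 1 Lsum0 Lsum0; under [X in T X]eq_fun do rewrite mulr0 addr0.
by apply: filterS => x /eqP; rewrite mul1r addrC -subr_eq subrr eq_sym => /eqP.
Qed.

Lemma dsZ a f : L1_plus_Loo mu f ->
  \forall x \ae mu, T (fun x => a * f x) x = a * T f x.
Proof.
move=> xf; have := ds_lin a xf Lsum0; under [X in T X]eq_fun do rewrite addr0.
by apply: filterS2 ds0 => x -> ->; rewrite addr0.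
Qed.

Lemma dsD f g : L1_plus_Loo mu f -> L1_plus_Loo mu g ->
  \forall x \ae mu, T (fun x => f x + g x) x = T f x + T g x.
Proof.
move=> xf xg; have := ds_lin 1 xf xg; under [X in T X]eq_fun do rewrite mul1r.
by apply: filterS => x ->; rewrite mul1r.
Qed.

Lemma dsB f g : L1_plus_Loo mu f -> L1_plus_Loo mu g ->
  \forall x \ae mu, T (fun x => f x - g x) x = T f x - T g x.
Proof.
move=> xf xg; have := ds_lin (-1) xg xf.
under [X in T X]eq_fun do rewrite mulN1r addrC.
by apply: filterS => x ->; rewrite mulN1r addrC.
Qed.

Lemma ds_sum n (F : 'I_n -> Omega -> R[i]) :
  (forall i, L1_plus_Loo mu (F i)) ->
  \forall x \ae mu, T (fun x => \sum_i F i x) x = \sum_i T (F i) x.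
Proof.
elim: n F => [|n IH] F HF.
  under [X in T X]eq_fun do rewrite big_ord0.
  by apply: filterS ds0 => x ->; rewrite big_ord0.
under [X in T X]eq_fun do rewrite big_ord_recl.
have := dsD (HF ord0) (Lsum_sum (fun i => HF (lift ord0 i))).
apply: filterS2 (IH _ (fun i => HF (lift ord0 i))) => x e ->.
by rewrite e big_ord_recl.
Qed.

(** The pointwise form of the [L^oo] contraction, which replaces a positive
    operator dominating [T]: multiplying the [F i] by constants of modulus at
    most 1 keeps the bound on their sum, [T] of that sum obeys the same bound,
    and countably many choices of the constants recover the sum of the moduli
    of the [T (F i)]. *)
Lemma ds_sum_cmod n (F : 'I_n -> Omega -> R[i]) c : 0 <= c ->
  (forall i, L1_plus_Loo mu (F i)) ->
  (\forall x \ae mu, \sum_i cmod (F i x) <= c) ->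
  \forall x \ae mu, \sum_i cmod (T (F i) x) <= c.
Proof.
move=> c0 HF Fc.
suff : \forall x \ae mu, forall p : {ffun 'I_n -> rat * rat},
    (forall i, cmod (phase (p i) : R[i]) <= 1) ->
    cmod (\sum_i phase (p i) * T (F i) x) <= c.
  by apply: filterS => x; exact: sum_cmod_phase.
apply: ae_countType => p.
have [p1|np1] := pselect (forall i, cmod (phase (p i) : R[i]) <= 1); last first.
  exact: aeW.
have xp i : L1_plus_Loo mu (fun x => phase (p i) * F i x) by exact: LsumZ.
have bp : \forall x \ae mu, cmod (\sum_i phase (p i) * F i x) <= c.
  apply: filterS Fc => x; apply: le_trans; rewrite (le_trans (cmod_sum _ _ _))//.
  by apply: ler_sum => i _; rewrite cmodM ler_piMl// cmod_ge0.
have := ds_bnd c0 (Lsum_meas (Lsum_sum xp)) bp.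
have eqs := ds_sum xp.
have eqz : \forall x \ae mu, forall i : 'I_n,
    T (fun x => phase (p i) * F i x) x = phase (p i) * T (F i) x.
  by apply: ae_countType => i; exact: dsZ.
apply: filterS3 eqs eqz => x + z + _ => -> /=.
by under eq_bigr do rewrite z.
Qed.

End operator.

Lemma ds_id : dunford_schwartz mu (fun f => f : Omega -> R[i]).
Proof. by split=> // a f g _ _; exact: ae_eq_refl. Qed.

Lemma ds_comp S T : dunford_schwartz mu S -> dunford_schwartz mu T ->
  dunford_schwartz mu (fun f => S (T f)).
Proof.
move=> hS hT; split.
- by move=> f xf; apply: (ds_stable hS); exact: (ds_stable hT).
- move=> f g xf xg fg; apply: (ds_ae_eq hS); [exact: (ds_stable hT)..|].
  exact: (ds_ae_eq hT).
- move=> a f g xf xg.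
  apply: ae_eq_trans (ds_linear hS a (ds_stable hT xf) (ds_stable hT xg)).
  apply: (ds_ae_eq hS); last exact: (ds_linear hT).
    by apply: (ds_stable hT); exact: LsumD.
  by apply: LsumD; exact: (ds_stable hT).
- move=> f f1; apply: le_trans (ds_L1 hT f1); apply: (ds_L1 hS).
  exact: (ds_cLp1 hT).
- move=> f f1; apply: le_trans (ds_Loo hT f1); apply: (ds_Loo hS).
  exact: (ds_cLpoo hT).
Qed.

Lemma ds_iter T k : dunford_schwartz mu T -> dunford_schwartz mu (iter k T).
Proof. by move=> hT; elim: k => [|k IH]; [exact: ds_id|exact: ds_comp]. Qed.

(** Rotating by a number of modulus 1 turns the averages with weights
    [lambda ^+ k] into plain Cesaro averages. *)
Lemma ds_rot T (lambda : R[i]) : cmod lambda = 1 -> dunford_schwartz mu T ->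
  dunford_schwartz mu (fun f x => lambda * T f x).
Proof.
move=> l1 hT; have nE p f : cLnorm mu p (fun x => lambda * T f x) = cLnorm mu p (T f).
  by apply: eq_Lnorm => x /=; rewrite cmodM l1 mul1r.
split.
- by move=> f xf; apply: LsumZ; exact: (ds_stable hT).
- move=> f g xf xg /(ds_ae_eq hT xf xg); apply: filterS => x h _.
  by rewrite h.
- move=> a f g xf xg; apply: filterS (ds_linear hT a xf xg) => x h _.
  by rewrite h// mulrDr !mulrA (mulrC a).
- by move=> f f1; rewrite nE; exact: (ds_L1 hT).
- by move=> f f1; rewrite nE; exact: (ds_Loo hT).
Qed.

Lemma iter_rot T (lambda : R[i]) k f : cmod lambda = 1 ->
  dunford_schwartz mu T -> L1_plus_Loo mu f ->
  \forall x \ae mu,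
    iter k (fun f x => lambda * T f x) f x = lambda ^+ k * iter k T f x.
Proof.
move=> l1 hT xf; elim: k => [|k IH]; first by apply: aeW => x; rewrite expr0 mul1r.
have hS := ds_rot l1 hT.
have xk := ds_stable (ds_iter k hT) xf.
have := ds_eq hT (ds_stable (ds_iter k hS) xf) (LsumZ (lambda ^+ k) xk) IH.
have := dsZ hT (lambda ^+ k) xk.
by apply: filterS2 => x /= e1 e2; rewrite e2 e1 exprS mulrA.
Qed.

End spaces.

(** * The maximal inequality *)

Section truncation.
Context {R : realType}.
Implicit Types (z : R[i]) (c : R).

(** The radial truncation of [z] to modulus [c]; at [z = 0] the quotient is 0
    and the formula gives 0, as it should. *)
Definition trunc c z : R[i] := (Num.min 1 (c / cmod z))%:C%C * z.

Lemma cmod_trunc c z : 0 <= c -> cmod (trunc c z) = Num.min (cmod z) c.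
Proof.
move=> c0; rewrite /trunc cmodM cmodR.
have [z0|z0] := eqVneq (cmod z) 0; first by rewrite z0 mulr0 min_l.
have zp : 0 < cmod z by rewrite lt_neqAle eq_sym z0 cmod_ge0.
rewrite ger0_norm; last by rewrite le_min ler01 divr_ge0// cmod_ge0.
by rewrite minr_pMl ?cmod_ge0// mul1r mulfVK.
Qed.

(** Radial truncation splits the modulus exactly, so that no mass is lost in
    the filling scheme. *)
Lemma cmod_trunc_res c z : 0 <= c ->
  cmod (z - trunc c z) = cmod z - cmod (trunc c z).
Proof.
move=> c0; rewrite /trunc -[X in X - _]mul1r -mulrBl !cmodM.
have m0 : 0 <= Num.min 1 (c / cmod z) by rewrite le_min ler01 divr_ge0// cmod_ge0.
have -> : 1 - (Num.min 1 (c / cmod z))%:C%C = (1 - Num.min 1 (c / cmod z))%:C%C :> R[i].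
  by rewrite rmorphB rmorph1.
rewrite !cmodR !ger0_norm//; last by rewrite subr_ge0 ge_min lexx.
by rewrite mulrBl mul1r.
Qed.

Lemma cmeas_trunc d (Omega : measurableType d) (c : Omega -> R) (f : Omega -> R[i]) :
  measurable_fun setT c -> cmeasurable f ->
  cmeasurable (fun x => trunc (c x) (f x)).
Proof.
move=> mc mf; apply: cmeasM => //; apply: cmeasR.
apply: (@measurable_minr _ _ _ _ (cst 1) (fun x => c x / cmod (f x))).
  exact: measurable_cst.
apply: measurable_funM => //.
(* the inverse is a power, and powers are measurable *)
have -> : (fun x => (cmod (f x))^-1) = (@powR R ^~ (-1)) \o (fun x => cmod (f x)).
  by apply/funext => x /=; rewrite powR_inv1// cmod_ge0.
exact: measurableT_comp (measurable_powR (-1)) (cmeas_cmod mf).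
Qed.

End truncation.

(** Summation along the antidiagonals of the times of absorption and travel. *)
Lemma triangle_sum (R : realType) (a : nat -> nat -> R) n :
  \sum_(k < n) \sum_(j < k.+1) a (k - j)%N j = \sum_(j < n) \sum_(i < n - j) a i j.
Proof.
elim: n => [|n IH]; first by rewrite !big_ord0.
rewrite big_ord_recr/= IH [RHS]big_ord_recr/= subSnn big_ord1.
rewrite [X in _ + X]big_ord_recr/= subnn addrA; congr (_ + _).
rewrite -big_split/=; apply: eq_bigr => j _.
by rewrite subSn 1?ltnW// big_ord_recr.
Qed.

Section maximal_inequality.
Context d (Omega : measurableType d) (R : realType).
Variable mu : {measure set Omega -> \bar R}.
Variable T : (Omega -> R[i]) -> Omega -> R[i].
Hypothesis hT : dunford_schwartz mu T.

Section filling.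
Variables (f : Omega -> R[i]) (lam : R).
Hypotheses (f1 : cLp mu 1%E f) (lam0 : 0 < lam).

(** The filling scheme: the mass [fillF k] arriving at time [k] is absorbed as
    far as the remaining capacity [fillc k] allows, and [T] moves the rest. *)
Fixpoint fill k : (Omega -> R[i]) * (Omega -> R) :=
  if k is k'.+1 then
    let: (F, c) := fill k' in
    (T (fun x => F x - trunc (c x) (F x)), fun x => c x - cmod (trunc (c x) (F x)))
  else (f, cst lam).

Definition fillF k := (fill k).1.
Definition fillc k := (fill k).2.
Definition fillg k x := trunc (fillc k x) (fillF k x).
Definition fillr k x := fillF k x - fillg k x.

Lemma fillFS k : fillF k.+1 = T (fillr k).
Proof. by rewrite /fillF /fillr /fillg /fillF /fillc /=; case: (fill k). Qed.

Lemma fillcS k x : fillc k.+1 x = fillc k x - cmod (fillg k x).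
Proof. by rewrite /fillg /fillF /fillc /=; case: (fill k). Qed.

Lemma fillc_ge0 k x : 0 <= fillc k x.
Proof.
elim: k => [|k IH]; first exact: ltW.
by rewrite fillcS subr_ge0 /fillg cmod_trunc// ge_min lexx orbT.
Qed.

Lemma fill_meas k : cLp mu 1%E (fillF k) /\ measurable_fun setT (fillc k).
Proof.
elim: k => [|k [IHF IHc]]; first by split=> //; exact: measurable_cst.
have [mF _] := iffLR (cLp1P mu _) IHF.
have mg : cmeasurable (fillg k) by exact: cmeas_trunc.
split.
  rewrite fillFS; apply: (ds_cLp1 hT); apply: (cLp1_le _ IHF); first exact: cmeasB.
  apply: aeW => x; rewrite cmod_trunc_res ?fillc_ge0// gerBl; exact: cmod_ge0.
have -> : fillc k.+1 = (fun x => fillc k x - cmod (fillg k x)).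
  by apply/funext => x; rewrite fillcS.
by apply: measurable_funB => //; exact: cmeas_cmod.
Qed.

Lemma fillF_meas k : cmeasurable (fillF k).
Proof. by have [/cLp1P[]] := fill_meas k. Qed.

Lemma fillg_meas k : cmeasurable (fillg k).
Proof. by apply: cmeas_trunc; [exact: (fill_meas k).2|exact: fillF_meas]. Qed.

Lemma fillg_cLp1 k : cLp mu 1%E (fillg k).
Proof.
apply: (cLp1_le (fillg_meas k) (fill_meas k).1); apply: aeW => x.
by rewrite cmod_trunc ?fillc_ge0// ge_min lexx.
Qed.

Lemma fillr_cLp1 k : cLp mu 1%E (fillr k).
Proof.
apply: (cLp1_le _ (fill_meas k).1).
  by apply: cmeasB; [exact: fillF_meas|exact: fillg_meas].
by apply: aeW => x; rewrite cmod_trunc_res ?fillc_ge0// gerBl; exact: cmod_ge0.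
Qed.

Lemma fill_mass n : (\sum_(j < n) L1n mu (fillg j) + L1n mu (fillF n) <= L1n mu f)%E.
Proof.
elim: n => [|n IH]; first by rewrite big_ord0 add0e.
apply: le_trans IH; rewrite big_ord_recr/= -addeA leeD2l//.
have -> : L1n mu (fillF n) = (L1n mu (fillg n) + L1n mu (fillr n))%E.
  rewrite /L1n -integD; [|by apply: nnegmf_cmod; exact: fillg_meas|].
    congr (integ mu _); apply/funext => x.
    by rewrite cmod_trunc_res ?fillc_ge0// addrC subrK.
  by apply: nnegmf_cmod; have /cLp1P[] := fillr_cLp1 n.
by rewrite leeD2l// fillFS; apply: (ds_L1n hT); exact: fillr_cLp1.
Qed.

Lemma fill_capacity n x : fillc n x + \sum_(j < n) cmod (fillg j x) = lam.
Proof.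
elim: n => [|n IH]; first by rewrite big_ord0 addr0.
by rewrite big_ord_recr/= fillcS [X in _ + X]addrC addrA subrK.
Qed.

(** What is not absorbed at time [k] exhausts the capacity, and the capacity never
    grows again. *)
Lemma fill_room n x k : 0 < fillc n x -> (k < n)%N -> fillr k x = 0.
Proof.
move=> cn; elim: n cn => // n IH cn; rewrite ltnS leq_eqVlt => /orP[/eqP ->|kn].
  apply: cmod_eq0; rewrite cmod_trunc_res ?fillc_ge0//.
  move: cn; rewrite fillcS subr_gt0 /fillg cmod_trunc ?fillc_ge0// gt_min ltxx orbF.
  by move=> /ltW/min_idPl ->; rewrite subrr.
apply: IH => //; apply: lt_le_trans cn _.
by rewrite fillcS gerBl cmod_ge0.
Qed.

(** At time [k] the function [iter k T f] consists of the parts absorbed earlier,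
    moved on by [T], and of the present residue. *)
Lemma fill_expand k : \forall x \ae mu,
  iter k T f x = \sum_(j < k.+1) iter (k - j) T (fillg j) x + fillr k x.
Proof.
elim: k => [|k IH].
  by apply: aeW => x; rewrite big_ord1 /= /fillr addrC subrK.
have Xg i j : L1_plus_Loo mu (iter i T (fillg j)).
  by apply: (ds_stable (ds_iter i hT)); apply: L1_Lsum; exact: fillg_cLp1.
have Xs : L1_plus_Loo mu (fun x => \sum_(j < k.+1) iter (k - j) T (fillg j) x).
  exact: Lsum_sum.
have Xr := L1_Lsum (fillr_cLp1 k).
have e1 := ds_eq hT (ds_stable (ds_iter k hT) (L1_Lsum f1)) (LsumDD Xs Xr) IH.
have e2 := dsD hT Xs Xr.
have e3 := ds_sum hT (fun j : 'I_k.+1 => Xg (k - j)%N j).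
apply: filterS3 e1 e2 e3 => x e1 e2 e3.
rewrite iterS e1 e2 e3 [in RHS]big_ord_recr/= subnn/= -addrA; congr (_ + _).
  by apply: eq_bigr => j _; rewrite -iterS subSn// -ltnS.
by rewrite /fillr addrC subrK fillFS.
Qed.

Lemma fill_sum_bound i n : \forall x \ae mu,
  \sum_(j < n) cmod (iter i T (fillg j) x) <= lam.
Proof.
apply: (ds_sum_cmod (ds_iter i hT) (F := fun j : 'I_n => fillg j)); first exact: ltW.
  by move=> j; apply: L1_Lsum; exact: fillg_cLp1.
apply: aeW => x; rewrite -[leRHS](fill_capacity n x) lerDr; exact: fillc_ge0.
Qed.

(** Where the capacity is not exhausted all residues vanish, and [n] applications
    of [fill_sum_bound] bound the [n] terms of the average. *)
Lemma fill_cover N : \forall x \ae mu, forall n, (n < N)%N ->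
  n%:R * lam < \sum_(k < n) cmod (iter k T f x) ->
  lam <= \sum_(j < N) cmod (fillg j x).
Proof.
have e1 : \forall x \ae mu, forall k,
    iter k T f x = \sum_(j < k.+1) iter (k - j) T (fillg j) x + fillr k x.
  by apply: ae_foralln; exact: fill_expand.
have e2 : \forall x \ae mu, forall i n,
    \sum_(j < n) cmod (iter i T (fillg j) x) <= lam.
  by apply: ae_foralln => i; apply: ae_foralln => n; exact: fill_sum_bound.
apply: filterS2 e1 e2 => x e1 e2 n nN; rewrite leNgt => big.
apply/negP => small.
have room : 0 < fillc N x.
  by rewrite -(ltrD2r (\sum_(j < N) cmod (fillg j x))) fill_capacity add0r.
move: big; apply/negP; rewrite -leNgt.
pose a i j := cmod (iter i T (fillg j) x).
apply: (@le_trans _ _ (\sum_(k < n) \sum_(j < k.+1) a (k - j)%N j)).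
  apply: ler_sum => k _; rewrite e1 (fill_room room); last exact: ltn_trans nN.
  rewrite addr0; exact: cmod_sum.
rewrite triangle_sum.
apply: (@le_trans _ _ (\sum_(j < n) \sum_(i < n) a i j)).
  apply: ler_sum => j _; rewrite (big_ord_widen n (fun i => a i j)) ?leq_subr//.
  rewrite [leRHS](bigID (fun i : 'I_n => (i < n - j)%N))/= lerDl.
  by apply: sumr_ge0 => i _; exact: cmod_ge0.
rewrite exchange_big/= mulr_natl -[X in _ *+ X]card_ord -sumr_const.
by apply: ler_sum => i _; exact: e2.
Qed.

End filling.

Lemma measurable_avg_gt (S : (Omega -> R[i]) -> Omega -> R[i]) f lam n :
  (forall k, cmeasurable (iter k S f)) ->
  measurable [set x | n%:R * lam < \sum_(k < n) cmod (iter k S f x)].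
Proof.
move=> mS; apply: measurable_ltr_set; first exact: measurable_cst.
by apply: measurable_sum => k; apply: cmeas_cmod.
Qed.

(** The weak type (1,1) inequality: off the set where the filling scheme
    exhausts the capacity [lam] there is never a residue, so that the averages
    there are averages of images of absorbed parts and are at most [lam]; and
    the absorbed mass is at most the norm of [f]. *)
Lemma weak_type11 f lam : cLp mu 1%E f -> 0 < lam ->
  (lam%:E * mu (\bigcup_n [set x | (n%:R * lam < \sum_(k < n) cmod (iter k T f x))%R])
   <= L1n mu f)%E.
Proof.
move=> f1 lam0.
have mS k : cmeasurable (iter k T f).
  exact: Lsum_meas (ds_stable (ds_iter k hT) (L1_Lsum f1)).
rewrite muleC -lee_pdivlMr//.
set A := fun n => [set x | _]; have mA n : measurable (A n) by exact: measurable_avg_gt.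
have -> : \bigcup_n A n = \bigcup_N \bigcup_(n in `I_N) A n.
  by apply/seteqP; split=> x => [[n _ xn]|[N _ [n _ xn]]];
    [exists n.+1 => //; exists n => /=|exists n].
apply: nondecreasing_mu_le => [N|N x [n nN xn]|N].
- by apply: bigcup_measurable => n _.
- by exists n => //=; rewrite ltnS ltnW.
rewrite lee_pdivlMr// muleC.
have nng j : nnegmf (fun x => cmod (fillg f lam j x)).
  by apply: nnegmf_cmod; exact: fillg_meas.
apply: (@le_trans _ _ (lam%:E * mu [set x | (lam <= \sum_(j < N) cmod (fillg f lam j x))%R])%E).
  rewrite lee_pmul2l//; apply: ae_le_mu.
  - by apply: bigcup_measurable => n _.
  - apply: measurable_ler_set; first exact: measurable_cst.
    exact: (nnegmf_sum (fun j : 'I_N => nng j)).1.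
  - by apply: filterS (fill_cover f1 lam0 N) => x H [n nN xn]; exact: H xn.
have := markov_integ mu lam0 (nnegmf_sum (fun j : 'I_N => nng j)).
move=> /le_trans; apply.
rewrite integ_sum//; apply: le_trans (fill_mass f1 lam0 N).
by rewrite leeDl// L1n_ge0.
Qed.

End maximal_inequality.

(** * Contraction in the square mean *)

(** Jensen's inequality for subprobability weights: expand the nonnegative sum
    [\sum_i w i * (a i - s) ^+ 2], where [s] is the weighted sum. *)
Lemma weighted_sq (R : realFieldType) n (a w : 'I_n -> R) :
  (forall i, 0 <= w i) -> \sum_i w i <= 1 ->
  (\sum_i w i * a i) ^+ 2 <= \sum_i w i * a i ^+ 2.
Proof.
move=> w0 w1; have [s sE] : {s | s = \sum_i w i * a i} by eexists.
rewrite -sE.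
have : 0 <= \sum_i w i * (a i - s) ^+ 2.
  by apply: sumr_ge0 => i _; rewrite mulr_ge0// sqr_ge0.
have -> : \sum_i w i * (a i - s) ^+ 2 =
    \sum_i w i * a i ^+ 2 - 2 * s * s + s ^+ 2 * \sum_i w i.
  have -> : 2 * s * s = \sum_i 2 * s * (w i * a i) by rewrite -mulr_sumr -sE.
  rewrite mulr_sumr -sumrB -big_split/=.
  by apply: eq_bigr => i _; ring.
have : s ^+ 2 * \sum_i w i <= s ^+ 2 by rewrite ler_piMr// sqr_ge0.
lra.
Qed.

Section L2.
Context d (Omega : measurableType d) (R : realType).
Variable mu : {measure set Omega -> \bar R}.
Implicit Types (f g h : Omega -> R[i]).

Definition L2n f : \bar R := integ mu (fun x => cmod (f x) ^+ 2).

Lemma L2n_ge0 f : (0 <= L2n f)%E.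
Proof. by apply: integ_ge0 => x; exact: sqr_ge0. Qed.

Lemma nnegmf_cmod2 f : cmeasurable f -> nnegmf (fun x => cmod (f x) ^+ 2).
Proof. by move=> mf; apply: nnegmfX; exact: nnegmf_cmod. Qed.

Lemma L2n_fin f : L1Loo mu f -> L2n f \is a fin_num.
Proof.
move=> [mf f1 [c [c0 fc]]]; rewrite ge0_fin_numE ?L2n_ge0//.
have nf := nnegmf_cmod mf.
apply: (@le_lt_trans _ _ (integ mu (fun x => c * cmod (f x)))).
  apply: le_integ; [exact: nnegmf_cmod2|exact: nnegmfZ|].
  by apply: filterS fc => x fc; rewrite expr2 ler_wpM2r// cmod_ge0.
by rewrite integZ//; apply: lte_mul_pinfty => //; rewrite lee_fin.
Qed.

(** Dividing by the upper end of the range of [|f|] makes the moduli of the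
    slices, whose supports are disjoint, sum to at most 1; multiplying back
    recovers [f]. *)
Definition slice (e : R) f i x : R[i] :=
  if Num.truncn (cmod (f x) / e) == i then ((i.+1%:R * e)^-1)%:C%C * f x else 0.

Lemma slice_meas e f i : 0 < e -> cmeasurable f -> cmeasurable (slice e f i).
Proof.
move=> e0 mf; pose A := [set x | i%:R * e <= cmod (f x)] `&`
  [set x | cmod (f x) < i.+1%:R * e].
have mA : measurable A.
  apply: measurableI.
    by apply: measurable_ler_set; [exact: measurable_cst|exact: cmeas_cmod].
  by apply: measurable_ltr_set; [exact: cmeas_cmod|exact: measurable_cst].
have -> : slice e f i = (fun x => (\1_A x)%:C%C * (((i.+1%:R * e)^-1)%:C%C * f x)).
  apply/funext => x; rewrite /slice truncn_eq; last by rewrite divr_ge0 ?cmod_ge0 ?ltW.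
  rewrite ler_pdivlMr// ltr_pdivrMr// indicE.
  case: ifPn => [/andP[x1 x2]|nA]; first by rewrite mem_set// mul1r.
  rewrite memNset ?mul0r// => -[x1 x2]; move/negP: nA; apply.
  by apply/andP.
apply: cmeasM; last by apply: cmeasZ.
by apply: cmeasR; exact: measurable_indic.
Qed.

Lemma slice_sum (e : R) f n (a : nat -> R) x :
  (Num.truncn (cmod (f x) / e) < n)%N ->
  \sum_(i < n) a i * cmod (slice e f i x) =
  let k := Num.truncn (cmod (f x) / e) in a k * cmod (((k.+1%:R * e)^-1)%:C%C * f x).
Proof.
move=> kn /=; rewrite (bigD1 (Ordinal kn))//= big1 ?addr0 /slice ?eqxx// => i.
by rewrite -val_eqE/= eq_sym => /negPf ->; rewrite cmod0 mulr0.
Qed.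

(** The [L^2] contraction without interpolation: cut [f] into slices on which
    [|f|] is constant up to [e], bound the slices pointwise with the [L^oo]
    contraction, and use convexity of the square. *)
Lemma ds_L2n T f : dunford_schwartz mu T -> L1Loo mu f -> (L2n (T f) <= L2n f)%E.
Proof.
move=> hT vf; have [mf f1 [M [M0 fM]]] := vf.
have nf := nnegmf_cmod mf.
have f1fin : L1n mu f \is a fin_num by rewrite ge0_fin_numE// L1n_ge0.
suff step (e : R) : 0 < e -> (L2n (T f) <= L2n f + e%:E * L1n mu f)%E.
  apply/lee_addgt0Pr => e e0.
  have p0 : 0 < fine (L1n mu f) + 1 by rewrite ltr_wpDl// fine_ge0// L1n_ge0.
  have := step (e / (fine (L1n mu f) + 1)) (divr_gt0 e0 p0).
  move=> /le_trans; apply; rewrite leeD2l// -[X in (_ * X)%E](fineK f1fin).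
  rewrite -EFinM lee_fin mulrAC ler_pdivrMr// ler_pM2l// lerDl//.
move=> e0; pose n := (Num.truncn (M / e)).+1.
pose a i := i.+1%:R * e; have a0 i : 0 < a i by rewrite mulr_gt0.
pose u i := slice e f i.
have mu_meas i : cmeasurable (u i) by exact: slice_meas.
have kn : \forall x \ae mu, (Num.truncn (cmod (f x) / e) < n)%N.
  by apply: filterS fM => x fM; rewrite ltnS le_truncn// ler_pM2r// invr_gt0.
have ub i x : cmod (u i x) <= cmod ((a i)^-1%:C%C * f x).
  by rewrite /u /slice; case: ifP => _ //; rewrite cmod0 cmod_ge0.
have vu i : L1Loo mu (u i).
  by apply: (L1Loo_le (mu_meas i) (L1LooZ ((a i)^-1%:C%C) vf)); apply: aeW => x; exact: ub.
have xu i := L1Loo_Lsum (vu i).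
have kub x : cmod (f x) < a (Num.truncn (cmod (f x) / e)).
  by rewrite /a -ltr_pdivrMr// truncnS_gt.
have klb x : (Num.truncn (cmod (f x) / e))%:R * e <= cmod (f x).
  by rewrite -ler_pdivlMr// truncn_le divr_ge0// ?cmod_ge0// ltW.
have sum1 : \forall x \ae mu, \sum_(i < n) cmod (u i x) <= 1.
  apply: filterS kn => x kx.
  under eq_bigr do rewrite -[cmod _]mul1r.
  rewrite (slice_sum (fun=> 1) kx)/= mul1r cmodM cmodR ger0_norm; last first.
    by rewrite invr_ge0 ltW// a0.
  by rewrite mulrC ler_pdivrMr ?a0// mul1r ltW.
have w1 := ds_sum_cmod hT ler01 (fun i : 'I_n => xu i) sum1.
have fE : \forall x \ae mu, f x = \sum_(i < n) (a i)%:C%C * u i x.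
  apply: filterS kn => x kx; rewrite (bigD1 (Ordinal kx))//= big1 ?addr0.
    rewrite /u /slice eqxx mulrA -rmorphM divff ?mul1r//; exact: lt0r_neq0.
  by move=> i; rewrite -val_eqE/= eq_sym /u /slice => /negPf ->; rewrite mulr0.
have xau (i : 'I_n) : L1_plus_Loo mu (fun x => (a i)%:C%C * u i x) by exact: LsumZ.
have e1 := ds_eq hT (L1Loo_Lsum vf) (Lsum_sum xau) fE.
have e2 := ds_sum hT xau.
have e3 : \forall x \ae mu, forall i : 'I_n,
    T (fun x => (a i)%:C%C * u i x) x = (a i)%:C%C * T (u i) x.
  by apply: ae_countType => i; exact: dsZ.
have Tf2 : \forall x \ae mu,
    cmod (T f x) ^+ 2 <= \sum_(i < n) a i ^+ 2 * cmod (T (u i) x).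
  apply: filterS3 (filterI e1 e2) e3 w1 => x [-> ->] e3 w1.
  apply: (@le_trans _ _ ((\sum_(i < n) cmod (T (u i) x) * a i) ^+ 2)).
    rewrite lerXn2r ?nnegrE ?cmod_ge0//.
      by apply: sumr_ge0 => i _; rewrite mulr_ge0 ?cmod_ge0// ltW.
    rewrite (le_trans (cmod_sum _ _ _))//; apply: ler_sum => i _.
    by rewrite e3 cmodM cmodR gtr0_norm// mulrC.
  have := @weighted_sq _ _ (fun i : 'I_n => a i) (fun i => cmod (T (u i) x))
    (fun i => cmod_ge0 _) w1.
  move=> /le_trans; apply.
  by under eq_bigr do rewrite mulrC.
have nTu i : nnegmf (fun x => cmod (T (u i) x)).
  by apply: nnegmf_cmod; have [] := ds_L1Loo hT (vu i).
have nu i := nnegmf_cmod (mu_meas i).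
have a2 i : 0 <= a i ^+ 2 by exact: sqr_ge0.
apply: (@le_trans _ _ (integ mu (fun x => \sum_(i < n) a i ^+ 2 * cmod (T (u i) x)))).
  apply: le_integ => //.
    by apply: nnegmf_cmod2; have [] := ds_L1Loo hT vf.
  by apply: (nnegmf_sum (F := fun (i : 'I_n) x => a i ^+ 2 * cmod (T (u i) x))) => i;
    exact: nnegmfZ.
rewrite (integ_sum mu (F := fun (i : 'I_n) x => a i ^+ 2 * cmod (T (u i) x))); last first.
  by move=> i; exact: nnegmfZ.
apply: (@le_trans _ _ (\sum_(i < n) (a i ^+ 2)%:E * L1n mu (u i))%E).
  apply: lee_sum => i _; rewrite integZ//; apply: lee_wpmul2l; first by rewrite lee_fin.
  by apply: (ds_L1n hT); exact: L1Loo_L1.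
under eq_bigr do rewrite /L1n -integZ//.
rewrite -(integ_sum mu (F := fun (i : 'I_n) x => a i ^+ 2 * cmod (u i x))); last first.
  by move=> i; exact: nnegmfZ.
have nef := nnegmfZ (ltW e0) nf.
have nf2 := nnegmf_cmod2 mf.
have -> : (L2n f + e%:E * L1n mu f =
    integ mu (fun x => (cmod (f x) ^+ 2 + e * cmod (f x))%R))%E.
  by rewrite (integD mu nf2 nef) (integZ mu (ltW e0) nf).
apply: le_integ.
- by apply: (nnegmf_sum (F := fun (i : 'I_n) x => a i ^+ 2 * cmod (u i x))) => i;
    exact: nnegmfZ.
- exact: nnegmfD.
apply: filterS kn => x kx; rewrite (slice_sum (fun i => a i ^+ 2) kx)/=.
rewrite cmodM cmodR ger0_norm; last by rewrite invr_ge0 ltW// a0.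
rewrite mulrA -/(a _) expr2 mulfK; last exact: lt0r_neq0.
rewrite expr2 -mulrDl ler_wpM2r ?cmod_ge0// /a -natr1 mulrDl mul1r lerD2r.
exact: klb.
Qed.

End L2.

(** * Almost uniform closeness *)

Section closeness.
Context d (Omega : measurableType d) (R : realType).
Variable mu : {measure set Omega -> \bar R}.
Implicit Types (F G H : nat -> Omega -> R[i]) (e : R).

(** Eventual uniform closeness up to [e] off a set of measure at most [e]. Null
    sets and finitely many indices are invisible to it, and almost uniform
    convergence to [f] is closeness to the constant sequence [f] for all [e]. *)
Definition au_close e F G := exists E : set Omega, [/\ measurable E,
  (mu E <= e%:E)%E & exists N, forall n, (N <= n)%N -> forall x, ~ E x ->
    cmod (F n x - G n x) <= e].

Lemma au_close_trans e1 e2 F G H :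
  au_close e1 F G -> au_close e2 G H -> au_close (e1 + e2) F H.
Proof.
move=> [E [mE Ee [N EH]]] [E' [mE' Ee' [N' EH']]]; exists (E `|` E'); split.
- exact: measurableU.
- by apply: le_trans (leU_mu mu mE mE') _; rewrite EFinD leeD.
- exists (maxn N N') => n; rewrite geq_max => /andP[Nn Nn'] x /not_orP[Ex Ex'].
  rewrite -[F n x](subrK (G n x)) -addrA (le_trans (cmodD _ _))//.
  by rewrite lerD// ?EH// EH'.
Qed.

Lemma au_closeD e1 e2 F F' G G' : au_close e1 F F' -> au_close e2 G G' ->
  au_close (e1 + e2) (fun n x => F n x + G n x) (fun n x => F' n x + G' n x).
Proof.
move=> [E [mE Ee [N EH]]] [E' [mE' Ee' [N' EH']]]; exists (E `|` E'); split.
- exact: measurableU.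
- by apply: le_trans (leU_mu mu mE mE') _; rewrite EFinD leeD.
- exists (maxn N N') => n; rewrite geq_max => /andP[Nn Nn'] x /not_orP[Ex Ex'].
  rewrite opprD addrACA (le_trans (cmodD _ _))//.
  by rewrite lerD// ?EH// EH'.
Qed.

Lemma au_closeZ e z F G : 0 < e -> au_close (e / (1 + cmod z)) F G ->
  au_close e (fun n x => z * F n x) (fun n x => z * G n x).
Proof.
move=> e0 [E [mE Ee [N EH]]]; exists E; split=> //.
  apply: le_trans Ee _; rewrite lee_fin ler_piMr ?(ltW e0)// invf_le1 ?ltr_pwDl ?cmod_ge0//.
  by rewrite lerDl cmod_ge0.
exists N => n Nn x Ex; rewrite -mulrBr cmodM.
apply: (@le_trans _ _ (cmod z * (e / (1 + cmod z)))).
  by rewrite ler_wpM2l ?cmod_ge0// EH.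
rewrite mulrCA ler_piMr ?(ltW e0)// ler_pdivrMr ?mul1r ?ltr_pwDl ?cmod_ge0//.
by rewrite lerDr.
Qed.

Lemma au_close_ae e F G N : 0 < e ->
  (forall n, (N <= n)%N -> \forall x \ae mu, cmod (F n x - G n x) <= e) ->
  au_close e F G.
Proof.
move=> e0 FG.
have : \forall x \ae mu, forall n, (N <= n)%N -> cmod (F n x - G n x) <= e.
  apply: ae_foralln => n; have [Nn|Nn] := leqP N n.
    by apply: filterS (FG n Nn).
  by apply: aeW.
move=> [E [mE E0 HE]]; exists E; split=> //; first by rewrite E0 lee_fin ltW.
exists N => n Nn x Ex; move: n Nn; apply: contrapT => nH.
by apply: Ex; exact: HE.
Qed.

Lemma au_close_bad e F G (E : set Omega) : 0 < e -> measurable E ->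
  (mu E <= e%:E)%E ->
  (forall n, (0 < n)%N -> \forall x \ae mu, ~ E x -> cmod (F n x - G n x) <= e) ->
  au_close e F G.
Proof.
move=> e0 mE Ee FG.
have : \forall x \ae mu, forall n, (0 < n)%N -> ~ E x -> cmod (F n x - G n x) <= e.
  apply: ae_foralln => -[|n]; first exact: aeW.
  by apply: filterS (FG n.+1 isT) => x H _.
move=> [N [mN N0 HN]]; exists (E `|` N); split.
- exact: measurableU.
- by rewrite measureU0.
- exists 1%N => n n0 x /not_orP[Ex Nx]; move: Ex; move: n n0.
  by apply: contrapT => nH; apply: Nx; exact: HN.
Qed.

(** Sequences close to constant ones: the almost uniform Cauchy property, in
    a form that passes to sums and limits without any measurability of [F]. *)
Definition au_cauchy F := forall e, 0 < e ->
  exists g, cmeasurable g /\ au_close e F (fun=> g).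

Lemma au_cauchyD F G : au_cauchy F -> au_cauchy G ->
  au_cauchy (fun n x => F n x + G n x).
Proof.
move=> cF cG e e0; have e2 : 0 < e / 2 by rewrite divr_gt0.
have [f [mf Ff]] := cF _ e2; have [g [mg Gg]] := cG _ e2.
exists (fun x => f x + g x); split; first exact: cmeasD.
by rewrite [e]splitr; exact: au_closeD.
Qed.

Lemma au_cauchyZ z F : au_cauchy F -> au_cauchy (fun n x => z * F n x).
Proof.
move=> cF e e0; have z0 : 0 < 1 + cmod z by rewrite ltr_pwDl// cmod_ge0.
have [f [mf Ff]] := cF _ (divr_gt0 e0 z0).
by exists (fun x => z * f x); split; [exact: cmeasZ|exact: au_closeZ].
Qed.

Lemma au_cauchy0 : au_cauchy (fun _ _ => 0).
Proof.
move=> e e0; exists (fun=> 0); split; first exact: cmeas_cst.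
exists set0; split=> //; first by rewrite measure0 lee_fin ltW.
by exists 0%N => n _ x _; rewrite subrr cmod0 ltW.
Qed.

Lemma au_cauchy_sum n (F : 'I_n -> nat -> Omega -> R[i]) :
  (forall i, au_cauchy (F i)) -> au_cauchy (fun m x => \sum_i F i m x).
Proof.
elim: n F => [|n IH] F cF.
  suff -> : (fun m x => \sum_(i < 0) F i m x) = (fun _ _ => 0) by exact: au_cauchy0.
  by apply/funext => m; apply/funext => x; rewrite big_ord0.
suff -> : (fun m x => \sum_(i < n.+1) F i m x) =
    (fun m x => F ord0 m x + \sum_(i < n) F (lift ord0 i) m x).
  by apply: au_cauchyD => //; exact: IH.
by apply/funext => m; apply/funext => x; rewrite big_ord_recl.
Qed.

Lemma au_cauchy_closed F :
  (forall e, 0 < e -> exists G, au_cauchy G /\ au_close e F G) -> au_cauchy F.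
Proof.
move=> HF e e0; have e2 : 0 < e / 2 by rewrite divr_gt0.
have [G [cG FG]] := HF _ e2; have [g [mg Gg]] := cG _ e2.
by exists g; split=> //; rewrite [e]splitr; exact: au_close_trans FG Gg.
Qed.

End closeness.


(** * Averages of a Dunford-Schwartz operator *)

Section mean_ergodic.
Context d (Omega : measurableType d) (R : realType).
Variable mu : {measure set Omega -> \bar R}.
Variable S : (Omega -> R[i]) -> Omega -> R[i].
Hypothesis hS : dunford_schwartz mu S.
Implicit Types (f g h : Omega -> R[i]).

Definition avg n f x : R[i] := n%:R^-1 * \sum_(k < n) iter k S f x.

Lemma L1Loo_iter k f : L1Loo mu f -> L1Loo mu (iter k S f).
Proof. exact: ds_L1Loo (ds_iter k hS) _. Qed.

Lemma L1Loo_avg n f : L1Loo mu f -> L1Loo mu (avg n f).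
Proof. by move=> vf; apply/L1LooZ/L1Loo_sum => k; exact: L1Loo_iter. Qed.

Lemma cmod_avg n f x : cmod (avg n f x) <= n%:R^-1 * \sum_(k < n) cmod (iter k S f x).
Proof. by rewrite cmodM cmodV cmod_nat ler_wpM2l ?invr_ge0// cmod_sum. Qed.

Lemma avgB n f g : L1Loo mu f -> L1Loo mu g ->
  \forall x \ae mu, avg n (fun x => f x - g x) x = avg n f x - avg n g x.
Proof.
move=> vf vg.
have : \forall x \ae mu, forall k,
    iter k S (fun x => f x - g x) x = iter k S f x - iter k S g x.
  by apply: ae_foralln => k; apply: (dsB (ds_iter k hS)); exact: L1Loo_Lsum.
apply: filterS => x H; rewrite /avg -mulrBr -sumrB; congr (_ * _).
by apply: eq_bigr.
Qed.

(** By convexity of the square it suffices to contract each term. *)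
Lemma avg_L2n n f : L1Loo mu f -> (L2n mu (avg n f) <= L2n mu f)%E.
Proof.
move=> vf; have mk k : cmeasurable (iter k S f) by have [] := L1Loo_iter k vf.
have nk k := nnegmf_cmod2 (mk k).
have n0 : 0 <= n%:R^-1 :> R by rewrite invr_ge0.
have nnk (k : 'I_n) := nnegmfZ n0 (nk k).
apply: (@le_trans _ _ (integ mu (fun x => \sum_(k < n) n%:R^-1 * cmod (iter k S f x) ^+ 2))).
  apply: le_integ.
  - by apply: nnegmf_cmod2; have [] := L1Loo_avg n vf.
  - exact: (nnegmf_sum nnk).
  apply: aeW => x.
  apply: (@le_trans _ _ ((\sum_(k < n) n%:R^-1 * cmod (iter k S f x)) ^+ 2)).
    rewrite lerXn2r ?nnegrE ?cmod_ge0//.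
      by apply: sumr_ge0 => k _; rewrite mulr_ge0// cmod_ge0.
    by rewrite -mulr_sumr cmod_avg.
  apply: (@weighted_sq _ _ (fun k : 'I_n => cmod (iter k S f x)) (fun=> n%:R^-1)) => //.
  rewrite sumr_const card_ord -[leLHS]mulr_natr; case: n {n0 nnk} => [|n].
    by rewrite mulr0.
  by rewrite mulVf.
rewrite (integ_sum mu nnk).
apply: (@le_trans _ _ (\sum_(k < n) (n%:R^-1)%:E * L2n mu f)%E).
  apply: lee_sum => k _; rewrite integZ//; apply: lee_wpmul2l => //.
  exact: (ds_L2n (ds_iter k hS) vf).
have L2f := L2n_fin vf.
rewrite -(fineK L2f); under eq_bigr do rewrite -EFinM.
rewrite sumEFin lee_fin sumr_const card_ord -[leLHS]mulr_natr mulrAC.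
case: n {n0 nnk} => [|n]; last by rewrite mulVf// mul1r.
by rewrite mulr0 mul0r fine_ge0// L2n_ge0.
Qed.

(** The weak type (2,2) inequality: the truncation of [f] at half the level
    contributes at most half the level to the averages, and the [L^1] norm of
    the rest is controlled by the square of [f]. *)
Lemma weak_type22 f lam : L1Loo mu f -> 0 < lam ->
  (((lam / 2) ^+ 2)%:E * mu (\bigcup_n [set x | (n%:R * lam < \sum_(k < n) cmod (iter k S f x))%R])
   <= L2n mu f)%E.
Proof.
move=> vf lam0; have lam2 : 0 < lam / 2 by rewrite divr_gt0.
have [mf f1 [M [M0 fM]]] := vf.
pose t x := trunc (lam / 2) (f x); pose r x := f x - t x.
have mt : cmeasurable t by apply: cmeas_trunc => //; exact: measurable_cst.
have vt : L1Loo mu t.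
  by apply: (L1Loo_le mt vf); apply: aeW => x; rewrite cmod_trunc ?(ltW lam2)// ge_min lexx.
have vr : L1Loo mu r by exact: L1LooB.
have mr : cmeasurable r by case: vr.
have tk : \forall x \ae mu, forall k, cmod (iter k S t x) <= lam / 2.
  apply: ae_foralln => k; apply: (ds_bnd (ds_iter k hS) (ltW lam2) mt).
  by apply: aeW => x; rewrite cmod_trunc ?(ltW lam2)// ge_min lexx orbT.
have rk : \forall x \ae mu, forall k, iter k S r x = iter k S f x - iter k S t x.
  by apply: ae_foralln => k; apply: (dsB (ds_iter k hS)); exact: L1Loo_Lsum.
have mS g : L1Loo mu g -> forall k, cmeasurable (iter k S g).
  by move=> vg k; have [] := L1Loo_iter k vg.
have := weak_type11 hS (L1Loo_L1 vr) lam2; set B := \bigcup_n _ => HB.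
have mB : measurable B by apply: bigcup_measurable => n _; apply: measurable_avg_gt; exact: mS.
set A := \bigcup_n _.
have mA : measurable A by apply: bigcup_measurable => n _; apply: measurable_avg_gt; exact: mS.
have AB : (mu A <= mu B)%E.
  apply: ae_le_mu => //; apply: filterS2 tk rk => x tk rk [n _ /= xn]; exists n => //=.
  have : \sum_(k < n) cmod (iter k S f x) <=
      \sum_(k < n) (cmod (iter k S r x) + lam / 2).
    apply: ler_sum => k _; rewrite -[X in cmod X](subrK (iter k S t x)) -rk.
    by rewrite (le_trans (cmodD _ _))// lerD2l.
  rewrite big_split/= sumr_const card_ord -[(lam / 2) *+ n]mulr_natl => le.
  have := lt_le_trans xn le.
  have -> : n%:R * lam = n%:R * (lam / 2) + n%:R * (lam / 2) by rewrite -mulrDr -splitr.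
  by rewrite ltrD2r.
have rL2 : (L1n mu r <= ((lam / 2)^-1)%:E * L2n mu f)%E.
  have c0 : 0 <= (lam / 2)^-1 by rewrite invr_ge0 ltW.
  rewrite -integZ//; last exact: nnegmf_cmod2.
  apply: le_integ; first exact: nnegmf_cmod.
    by apply: nnegmfZ => //; exact: nnegmf_cmod2.
  apply: aeW => x; rewrite cmod_trunc_res ?(ltW lam2)// cmod_trunc ?(ltW lam2)//.
  have [fl|fl] := leP (cmod (f x)) (lam / 2).
    by rewrite subrr mulr_ge0// sqr_ge0.
  apply: (@le_trans _ _ (cmod (f x))); first by rewrite gerBl ltW.
  rewrite mulrC ler_pdivlMr// expr2 ler_wpM2l ?cmod_ge0//; exact: ltW.
rewrite expr2 EFinM -muleA.
apply: (@le_trans _ _ ((lam / 2)%:E * L1n mu r)%E).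
  apply: lee_wpmul2l; first by rewrite lee_fin ltW.
  apply: le_trans HB; apply: lee_wpmul2l => //; by rewrite lee_fin ltW.
apply: le_trans (lee_wpmul2l _ rL2) _; first by rewrite lee_fin ltW.
by rewrite muleA -EFinM divff ?mul1e// lt0r_neq0.
Qed.

(** The transfer function is required to be bounded, so that the averages of a
    coboundary tend to 0 uniformly and not only in the mean. *)
Definition cobound h := exists v, L1Loo mu v /\ \forall x \ae mu, h x = v x - S v x.

Lemma cobound_ae h h' : (\forall x \ae mu, h x = h' x) -> cobound h -> cobound h'.
Proof.
move=> hh' [v [vv hv]]; exists v; split=> //.
by apply: filterS2 hh' hv => x <-.
Qed.

Lemma coboundD a h h' : cobound h -> cobound h' -> cobound (fun x => a * h x + h' x).
Proof.
move=> [v [vv hv]] [w [vw hw]]; exists (fun x => a * v x + w x); split; first exact: L1LooD.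
apply: filterS3 hv hw (ds_lin hS a (L1Loo_Lsum vv) (L1Loo_Lsum vw)) => x -> -> ->.
by ring.
Qed.

Lemma cobound0 : cobound (fun=> 0).
Proof.
exists (fun=> 0); split; first exact: L1Loo0.
by apply: filterS (ds0 hS) => x ->; rewrite subr0.
Qed.

Lemma cobound_iter f k : L1Loo mu f -> cobound (fun x => f x - iter k S f x).
Proof.
move=> vf; elim: k => [|k IH].
  by under eq_fun do rewrite subrr; exact: cobound0.
have ck : cobound (fun x => iter k S f x - iter k.+1 S f x).
  by exists (iter k S f); split; [exact: L1Loo_iter|exact: aeW].
apply: cobound_ae (coboundD 1 IH ck); apply: aeW => x.
by rewrite mul1r addrA subrK.
Qed.

(** Each [f - iter k S f] telescopes into a coboundary. *)
Lemma cobound_avg f n : (0 < n)%N -> L1Loo mu f -> cobound (fun x => f x - avg n f x).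
Proof.
move=> n0 vf.
have H m : cobound (fun x => \sum_(k < m) (f x - iter k S f x)).
  elim: m => [|m IH]; first by under eq_fun do rewrite big_ord0; exact: cobound0.
  apply: cobound_ae (coboundD 1 IH (cobound_iter m vf)); apply: aeW => x.
  by rewrite mul1r big_ord_recr.
apply: cobound_ae (coboundD n%:R^-1 (H n) cobound0); apply: aeW => x.
rewrite addr0 sumrB mulrBr sumr_const card_ord -[f x *+ n]mulr_natl mulrA mulVf ?mul1r//.
by rewrite pnatr_eq0 -lt0n.
Qed.

(** Averages of a coboundary telescope. *)
Lemma avg_cobound h : L1Loo mu h -> cobound h ->
  exists c, 0 <= c /\ forall n, \forall x \ae mu, cmod (avg n h x) <= n%:R^-1 * c.
Proof.
move=> vh [v [vv hv]]; have [mv _ [c [c0 vc]]] := vv.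
exists (2 * c); split; first by rewrite mulr_ge0.
move=> n.
have vk : \forall x \ae mu, forall k, cmod (iter k S v x) <= c.
  by apply: ae_foralln => k; exact: (ds_bnd (ds_iter k hS)).
have hk : \forall x \ae mu, forall k, iter k S h x = iter k S v x - iter k.+1 S v x.
  apply: ae_foralln => k.
  have xv := L1Loo_Lsum vv; have xSv := ds_stable hS xv.
  have e1 := ds_eq (ds_iter k hS) (L1Loo_Lsum vh) (L1Loo_Lsum (L1LooB vv (ds_L1Loo hS vv))) hv.
  have e2 := dsB (ds_iter k hS) xv xSv.
  by apply: filterS2 e1 e2 => x -> ->; rewrite iterSr.
apply: filterS2 vk hk => x vk hk; rewrite /avg cmodM cmodV cmod_nat ler_wpM2l ?invr_ge0//.
under eq_bigr do rewrite hk.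
have -> : \sum_(k < n) (iter k S v x - iter k.+1 S v x) = v x - iter n S v x.
  elim: n => [|n IH]; first by rewrite big_ord0 subrr.
  by rewrite big_ord_recr/= IH addrA subrK.
rewrite (le_trans (cmodB _ _))// mulr_natl mulr2n lerD//; exact: (vk 0%N).
Qed.

End mean_ergodic.

(** * The mean ergodic theorem and its almost uniform form *)

Section mean_ergodic_theorem.
Context d (Omega : measurableType d) (R : realType).
Variable mu : {measure set Omega -> \bar R}.
Variable S : (Omega -> R[i]) -> Omega -> R[i].
Hypothesis hS : dunford_schwartz mu S.
Implicit Types (f g h : Omega -> R[i]).

Definition sqn f : R := fine (L2n mu f).

Lemma sqn_ge0 f : 0 <= sqn f.
Proof. by rewrite fine_ge0// L2n_ge0. Qed.

Lemma L2nE f : L1Loo mu f -> L2n mu f = (sqn f)%:E.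
Proof. by move=> vf; rewrite fineK// L2n_fin. Qed.

Lemma L1Loo_mid g h : L1Loo mu g -> L1Loo mu h -> L1Loo mu (fun x => 2^-1 * (g x + h x)).
Proof. by move=> vg vh; apply: L1LooZ; exact: L1LooDD. Qed.

Lemma sqn_parallelogram g h : L1Loo mu g -> L1Loo mu h ->
  sqn (fun x => g x - h x) =
  2 * sqn g + 2 * sqn h - 4 * sqn (fun x => 2^-1 * (g x + h x)).
Proof.
move=> vg vh; have vm := L1Loo_mid vg vh; have vB := L1LooB vg vh.
have n2 f : L1Loo mu f -> nnegmf (fun x => cmod (f x) ^+ 2).
  by case=> mf _ _; exact: nnegmf_cmod2.
have z2 : 0 <= 2 :> R by []. have z4 : 0 <= 4 :> R by [].
have : integ mu (fun x => cmod (g x - h x) ^+ 2 + 4 * cmod (2^-1 * (g x + h x)) ^+ 2) =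
    integ mu (fun x => 2 * cmod (g x) ^+ 2 + 2 * cmod (h x) ^+ 2).
  by congr (integ mu _); apply/funext => x; rewrite cmod_parallelogram subrK.
rewrite (integD mu (n2 _ vB) (nnegmfZ z4 (n2 _ vm))) (integZ mu z4 (n2 _ vm)).
rewrite (integD mu (nnegmfZ z2 (n2 _ vg)) (nnegmfZ z2 (n2 _ vh))).
rewrite (integZ mu z2 (n2 _ vg)) (integZ mu z2 (n2 _ vh)) -!/(L2n mu _) !L2nE//.
by rewrite -!EFinM -!EFinD => -[<-]; rewrite addrK.
Qed.

(** The affine space in which the projection of [f] onto the fixed vectors is
    looked for, as the element of least [L^2] norm. *)
Definition cobound_class f : set (Omega -> R[i]) :=
  [set g | L1Loo mu g /\ cobound mu S (fun x => f x - g x)].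

Lemma cobound_class_mid f g h : cobound_class f g -> cobound_class f h ->
  cobound_class f (fun x => 2^-1 * (g x + h x)).
Proof.
move=> [vg cg] [vh ch]; split; first exact: L1Loo_mid.
have := coboundD hS 2^-1 cg (coboundD hS 2^-1 ch (cobound0 hS)).
by apply: cobound_ae; apply: aeW => x /=; field.
Qed.

Lemma cobound_class_avg f g n : (0 < n)%N -> cobound_class f g ->
  cobound_class f (avg S n g).
Proof.
move=> n0 [vg cg]; split; first exact: L1Loo_avg.
apply: cobound_ae (coboundD hS 1 cg (cobound_avg hS n0 vg)); apply: aeW => x.
by rewrite mul1r addrA subrK.
Qed.

(** Minimisers need not exist in the class, which is not closed; near minimisers
    are enough. *)
Definition near_min f eta g := cobound_class f g /\
  forall h, cobound_class f h -> sqn g <= sqn h + eta.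

Lemma near_min_exists f eta : L1Loo mu f -> 0 < eta -> exists g, near_min f eta g.
Proof.
move=> vf eta0; pose A := [set sqn g | g in cobound_class f].
have lA : lbound A 0 by move=> _ [g _ <-]; exact: sqn_ge0.
have hA : has_inf A.
  split; last by exists 0.
  exists (sqn f), f => //; split=> //.
  by under eq_fun do rewrite subrr; exact: cobound0.
have [_ [g Kg <-] gA] := inf_adherent eta0 hA.
exists g; split=> // h Kh; rewrite (le_trans (ltW gA))// lerD2r.
by apply: inf_lbound; [exact: hA.2|exists h].
Qed.

(** The midpoint stays in the class and cannot have a much smaller norm, so the
    parallelogram identity forces the two near minimisers together. *)
Lemma near_min_sqnB f eta eta' g h : near_min f eta g -> near_min f eta' h ->
  sqn (fun x => g x - h x) <= 4 * eta + 2 * eta'.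
Proof.
move=> [Kg ming] [Kh minh]; rewrite sqn_parallelogram; [|exact: Kg.1|exact: Kh.1].
have := ming _ (cobound_class_mid Kg Kh); have := minh _ Kg.
lra.
Qed.

(** The same argument applied to [g] and its own average, whose norm is not
    larger: near minimisers are nearly invariant. *)
Lemma near_min_avg f eta g n : (0 < n)%N -> near_min f eta g ->
  sqn (fun x => g x - avg S n g x) <= 4 * eta.
Proof.
move=> n0 [Kg ming]; have Ka := cobound_class_avg n0 Kg.
rewrite sqn_parallelogram; [|exact: Kg.1|exact: Ka.1].
have := ming _ (cobound_class_mid Kg Ka).
have : sqn (avg S n g) <= sqn g.
  by rewrite -lee_fin -!L2nE; [apply: (avg_L2n hS); exact: Kg.1|exact: Kg.1|exact: Ka.1].
lra.
Qed.

(** A maximal estimate that does not depend on [M]. The averages of [g] are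
    compared with those of a better minimiser [h], chosen after [M]: the weak
    type (2,2) inequality controls all averages of [g - h] at once, and [h] is so
    nearly invariant that the [M] exceptional sets for [h] are summed. *)
Lemma near_min_maximal f eta g lam M : L1Loo mu f -> 0 < eta -> 0 < lam ->
  near_min f eta g ->
  (mu (\bigcup_(n in `I_M) [set x | (3 * lam < cmod (avg S n.+1 g x - g x))%R]) <=
   (24 * eta / lam ^+ 2)%:E)%E.
Proof.
move=> vf eta0 lam0 ng; have vg : L1Loo mu g := ng.1.1.
pose eta' := eta / (4 * M.+1%:R).
have eta'0 : 0 < eta' by rewrite divr_gt0// mulr_gt0.
have [h nh] := near_min_exists vf eta'0; have vh : L1Loo mu h := nh.1.1.
have vgh := L1LooB vg vh.
have mV k : L1Loo mu k -> cmeasurable k by case.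
have lam2 : 0 < lam ^+ 2 by rewrite exprn_gt0.
pose A := \bigcup_n [set x | n%:R * lam < \sum_(k < n) cmod (iter k S (fun x => g x - h x) x)].
have mA : measurable A.
  apply: bigcup_measurable => n _; apply: measurable_avg_gt => k.
  by have [] := L1Loo_iter hS k vgh.
have muA : (mu A <= (4 * (4 * eta + 2 * eta') / lam ^+ 2)%:E)%E.
  have := weak_type22 hS vgh lam0; rewrite -/A L2nE//.
  have e4 : (lam / 2) ^+ 2 = lam ^+ 2 / 4 by field.
  rewrite e4 muleC -lee_pdivlMr ?divr_gt0// => /le_trans; apply.
  rewrite -EFinM lee_fin invf_div mulrC mulrAC ler_pM2r ?invr_gt0// ler_wpM2l//.
  exact: near_min_sqnB ng nh.
pose B n := [set x | lam ^+ 2 <= cmod (h x - avg S n.+1 h x) ^+ 2].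
have vB n : L1Loo mu (fun x => h x - avg S n.+1 h x).
  by apply: L1LooB => //; exact: L1Loo_avg.
have nB n := nnegmf_cmod2 (mV _ (vB n)).
have mB n : measurable (B n).
  by apply: measurable_ler_set; [exact: measurable_cst|exact: (nB n).1].
have muB n : (mu (B n) <= (4 * eta' / lam ^+ 2)%:E)%E.
  have := markov_integ mu lam2 (nB n); rewrite -/(B n) -/(L2n mu _) L2nE//.
  rewrite muleC -lee_pdivlMr// => /le_trans; apply.
  rewrite -EFinM lee_fin ler_pM2r ?invr_gt0//.
  exact: near_min_avg nh.
pose BM := \big[setU/set0]_(n < M) B n.
have mBM : measurable BM by apply: bigsetU_measurable => n _.
have muBM : (mu BM <= (M%:R * (4 * eta' / lam ^+ 2))%:E)%E.
  apply: le_trans (Boole_inequality _ _) _ => //.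
  apply: (@le_trans _ _ (\sum_(n < M) (4 * eta' / lam ^+ 2)%:E)%E).
    by apply: lee_sum => n _; exact: muB.
  by rewrite sumEFin lee_fin sumr_const card_ord [leRHS]mulr_natl.
apply: (@le_trans _ _ (mu (A `|` BM))).
  apply: ae_le_mu.
  - apply: bigcup_measurable => n _; apply: measurable_ltr_set.
      exact: measurable_cst.
    by apply: cmeas_cmod; apply: mV; apply: L1LooB => //; exact: L1Loo_avg.
  - exact: measurableU.
  have : \forall x \ae mu, forall n, avg S n (fun x => g x - h x) x = avg S n g x - avg S n h x.
    by apply: ae_foralln => n; exact: avgB.
  apply: filterS => x avE [n nM /= xn]; apply: contrapT => /not_orP[nA nB'].
  have A' m : \sum_(k < m) cmod (iter k S (fun x => g x - h x) x) <= m%:R * lam.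
    by rewrite leNgt; apply/negP => xm; apply: nA; exists m.
  have g1 : cmod (g x - h x) <= lam by have := A' 1%N; rewrite big_ord1 mul1r.
  have g2 : cmod (avg S n.+1 g x - avg S n.+1 h x) <= lam.
    rewrite -avE (le_trans (cmod_avg _ _ _ _))// mulrC ler_pdivrMr// mulrC.
    exact: A'.
  have g3 : cmod (h x - avg S n.+1 h x) <= lam.
    rewrite leNgt; apply/negP => xB; apply: nB'; rewrite /BM -bigcup_mkord.
    by exists n => //; rewrite /B /= lerXn2r// ?nnegrE ?cmod_ge0// ltW.
  move: xn; apply/negP; rewrite -leNgt.
  have -> : avg S n.+1 g x - g x = (avg S n.+1 g x - avg S n.+1 h x)
      - (h x - avg S n.+1 h x) - (g x - h x) by ring.
  have := cmodB (avg S n.+1 g x - avg S n.+1 h x - (h x - avg S n.+1 h x)) (g x - h x).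
  have := cmodB (avg S n.+1 g x - avg S n.+1 h x) (h x - avg S n.+1 h x).
  lra.
apply: le_trans (leU_mu mu mA mBM) _; apply: le_trans (leeD muA muBM) _.
rewrite -EFinD lee_fin mulrA -mulrDl ler_pM2r ?invr_gt0//.
have eE : eta' = eta / 4 / M.+1%:R by rewrite /eta' invfM mulrA.
have Me : M%:R * eta' <= eta / 4.
  rewrite eE mulrCA ler_piMr//; first by rewrite divr_ge0// ltW.
  by rewrite ler_pdivrMr// mul1r ler_nat.
have e'e : eta' <= eta / 4.
  by rewrite eE ler_piMr// ?divr_ge0 ?(ltW eta0)// invf_le1// ler1n.
have -> : M%:R * (4 * eta') = 4 * (M%:R * eta') by ring.
move: (M%:R * eta') Me => z; move: eta0 e'e; clearbody eta'; lra.
Qed.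

(** Up to a coboundary, [f] is a near minimiser [g], and the averages of [g] are
    almost uniformly close to [g] itself. *)
Theorem mean_ergodic f e : L1Loo mu f -> 0 < e ->
  exists g, L1Loo mu g /\ au_close mu e (fun n => avg S n f) (fun=> g).
Proof.
move=> vf e0; have lam0 : 0 < e / 6 by rewrite divr_gt0.
have e20 : 0 < e / 2 by rewrite divr_gt0.
have l2 : 0 < (e / 6) ^+ 2 by rewrite exprn_gt0.
have eta0 : 0 < e / 2 * (e / 6) ^+ 2 / 24 by rewrite divr_gt0// mulr_gt0.
have [g ng] := near_min_exists vf eta0; have vg : L1Loo mu g := ng.1.1.
exists g; split=> //; rewrite [X in au_close _ X]splitr.
apply: (@au_close_trans _ _ _ _ _ _ _ (fun n => avg S n g)).
  have [c [c0 Hc]] := avg_cobound hS (L1LooB vf vg) ng.1.2.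
  pose N := (Num.truncn (c / (e / 2))).+1.
  apply: (@au_close_ae _ _ _ _ _ _ _ N) => // n Nn.
  apply: filterS2 (avgB hS n vf vg) (Hc n) => x <- /le_trans; apply.
  have n0 : (0 < n)%N by rewrite (leq_trans _ Nn).
  rewrite mulrC ler_pdivrMr ?ltr0n// -ler_pdivrMl// mulrC.
  by rewrite (le_trans (ltW (truncnS_gt _)))// ler_nat.
pose A n := [set x | 3 * (e / 6) < cmod (avg S n.+1 g x - g x)].
have mA n : measurable (A n).
  apply: measurable_ltr_set; first exact: measurable_cst.
  by apply: cmeas_cmod; have [] := L1LooB (L1Loo_avg hS n.+1 vg) vg.
have e3 : 3 * (e / 6) = e / 2 by field.
apply: (@au_close_bad _ _ _ _ _ _ _ (\bigcup_n A n)) => //.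
- exact: bigcup_measurable.
- have -> : \bigcup_n A n = \bigcup_N \bigcup_(n in `I_N) A n.
    by apply/seteqP; split=> x => [[n _ xn]|[N _ [n _ xn]]];
      [exists n.+1 => //; exists n => /=|exists n].
  apply: nondecreasing_mu_le => [N|N x [n nN xn]|N].
  + by apply: bigcup_measurable => n _.
  + by exists n => //=; rewrite ltnS ltnW.
  + apply: le_trans (near_min_maximal N vf eta0 lam0 ng) _.
    rewrite lee_fin mulrC mulrA ler_pdivrMl// mulrC.
    by rewrite le_eqVlt; apply/orP; left; apply/eqP; field.
- move=> [//|n] _; apply: aeW => x nA; rewrite leNgt; apply/negP => xn.
  by apply: nA; exists n => //; rewrite /A /= e3.
Qed.

End mean_ergodic_theorem.

(** * Besicovitch weights *)

Section besicovitch.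
Context d (Omega : measurableType d) (R : realType).
Variable mu : {measure set Omega -> \bar R}.
Variable T : (Omega -> R[i]) -> Omega -> R[i].
Hypothesis hT : dunford_schwartz mu T.
Implicit Types (f g : Omega -> R[i]) (beta : nat -> R[i]).

Lemma au_cauchy_ae F G : (forall n, \forall x \ae mu, F n x = G n x) ->
  au_cauchy mu G -> au_cauchy mu F.
Proof.
move=> FG cG; apply: au_cauchy_closed => e e0; exists G; split=> //.
apply: (@au_close_ae _ _ _ _ _ _ _ 0%N) => // n _.
by apply: filterS (FG n) => x ->; rewrite subrr cmod0 ltW.
Qed.

Lemma au_cauchy_rot f (lambda : R[i]) : L1Loo mu f -> cmod lambda = 1 ->
  au_cauchy mu (weighted_avg (fun k => lambda ^+ k) T f).
Proof.
move=> vf l1; have hS := ds_rot l1 hT.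
apply: (@au_cauchy_ae _ (fun n => avg (fun f x => lambda * T f x) n f)).
  move=> n; have : \forall x \ae mu, forall k,
      iter k (fun f x => lambda * T f x) f x = lambda ^+ k * iter k T f x.
    by apply: ae_foralln => k; apply: iter_rot => //; exact: L1Loo_Lsum.
  by apply: filterS => x H; rewrite /avg; under eq_bigr do rewrite H.
move=> e e0; have [g [vg Hg]] := mean_ergodic hS vf e0.
by exists g; split=> //; case: vg.
Qed.

Lemma au_cauchy_trig f (P : int -> R[i]) : L1Loo mu f -> trig_poly P ->
  au_cauchy mu (weighted_avg (fun k => P k%:Z) T f).
Proof.
move=> vf [s [z [l [l1 PE]]]].
suff -> : weighted_avg (fun k => P k%:Z) T f = (fun n x =>
    \sum_(j < s) z j * weighted_avg (fun k => l j ^+ k) T f n x).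
  by apply: au_cauchy_sum => j; apply/au_cauchyZ/au_cauchy_rot.
apply/funext => n; apply/funext => x; rewrite /weighted_avg.
under [RHS]eq_bigr do rewrite mulrCA mulr_sumr.
rewrite -mulr_sumr; congr (_ * _); rewrite exchange_big/=.
apply: eq_bigr => k _; rewrite PE mulr_suml.
by apply: eq_bigr => j _; rewrite mulrA.
Qed.

Lemma limn_esup_lt (u : nat -> \bar R) (e : \bar R) : (limn_esup u < e)%E ->
  exists N, forall n, (N <= n)%N -> (u n <= e)%E.
Proof.
rewrite limn_esup_lim (cvg_lim _ (@cvg_esups_inf _ u))//.
move=> /ereal_inf_lt[_ [N _ <-] uN]; exists N => n Nn.
by apply: le_trans (ltW uN); apply: ereal_sup_ubound; exists n.
Qed.

Lemma cmod_weighted_avg beta f n x :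
  cmod (weighted_avg beta T f n x) <=
  n%:R^-1 * \sum_(k < n) cmod (beta k) * cmod (iter k T f x).
Proof.
rewrite cmodM cmodV cmod_nat ler_wpM2l ?invr_ge0// (le_trans (cmod_sum _ _ _))//.
by apply: ler_sum => k _; rewrite cmodM.
Qed.

(** For a bounded function the error made by replacing the weights by a
    trigonometric polynomial is at most the bound times the mean of the moduli
    of the weight differences. *)
Lemma au_cauchy_L1Loo beta f : bounded_besicovitch beta -> L1Loo mu f ->
  au_cauchy mu (weighted_avg beta T f).
Proof.
move=> [_ hb] vf; apply: au_cauchy_closed => e e0.
have [mf _ [c [c0 fc]]] := vf.
have c1 : 0 < c + 1 by rewrite ltr_wpDl.
have [P [tP Plim]] := hb _ (divr_gt0 e0 c1).
exists (weighted_avg (fun k => P k%:Z) T f); split; first exact: au_cauchy_trig.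
have [N HN] := limn_esup_lt Plim.
apply: (@au_close_ae _ _ _ _ _ _ _ N) => // n Nn.
have fk : \forall x \ae mu, forall k, cmod (iter k T f x) <= c.
  by apply: ae_foralln => k; exact: (ds_bnd (ds_iter k hT)).
apply: filterS fk => x fk.
have -> : weighted_avg beta T f n x - weighted_avg (fun k => P k%:Z) T f n x =
    weighted_avg (fun k => beta k - P k%:Z) T f n x.
  rewrite /weighted_avg -mulrBr -sumrB; congr (_ * _).
  by apply: eq_bigr => k _; rewrite mulrBl.
apply: le_trans (cmod_weighted_avg _ _ _ _) _.
apply: (@le_trans _ _ (n%:R^-1 * \sum_(k < n) cmod (beta k - P k%:Z) * c)).
  rewrite ler_wpM2l ?invr_ge0//; apply: ler_sum => k _.
  by rewrite ler_wpM2l ?cmod_ge0.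
rewrite -mulr_suml mulrA; have := HN n Nn; rewrite lee_fin => h.
apply: (@le_trans _ _ (e / (c + 1) * c)); first by rewrite ler_wpM2r.
by rewrite -mulrA ler_piMr// ?(ltW e0)// mulrC ler_pdivrMr// mul1r lerDl.
Qed.

(** Truncate at height [n]. If all the tails had norm above [e], the truncations
    would have norm at most that of [f] minus [e], and so would [f] by Fatou. *)
Lemma L1_truncation f e : cLp mu 1%E f -> 0 < e ->
  exists g, [/\ L1Loo mu g, cLp mu 1%E (fun x => f x - g x) &
    (L1n mu (fun x => f x - g x)%R <= e%:E)%E].
Proof.
move=> f1 e0; have [mf L1f] := iffLR (cLp1P mu _) f1.
pose g (n : nat) x := trunc n%:R (f x).
have mg n : cmeasurable (g n) by apply: cmeas_trunc => //; exact: measurable_cst.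
have gE n x : cmod (g n x) = Num.min (cmod (f x)) n%:R by rewrite cmod_trunc.
have g1 n : cLp mu 1%E (g n).
  by apply: (cLp1_le (mg n) f1); apply: aeW => x; rewrite gE ge_min lexx.
have vg n : L1Loo mu (g n).
  have [_ g1n] := iffLR (cLp1P mu _) (g1 n).
  split=> //; exists n%:R; split=> //; apply: aeW => x.
  by rewrite gE ge_min lexx orbT.
have mB n : cmeasurable (fun x => f x - g n x) by exact: cmeasB.
have BE n x : cmod (f x - g n x) = cmod (f x) - cmod (g n x) by rewrite cmod_trunc_res.
have B1 n : cLp mu 1%E (fun x => f x - g n x).
  apply: (cLp1_le (mB n) f1); apply: aeW => x.
  by rewrite BE gerBl cmod_ge0.
apply: contrapT => H.
have Hn n : (e%:E + L1n mu (g n) <= L1n mu f)%E.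
  have -> : L1n mu f = (L1n mu (fun x => f x - g n x)%R + L1n mu (g n))%E.
    rewrite /L1n -integD; [|exact: nnegmf_cmod..].
    by congr (integ mu _); apply/funext => x; rewrite BE subrK.
  rewrite leeD2r//; apply/ltW; rewrite ltNge; apply/negP => le.
  by apply: H; exists (g n); split.
have fin : L1n mu f \is a fin_num by rewrite ge0_fin_numE// L1n_ge0.
have : (L1n mu f <= L1n mu f - e%:E)%E.
  apply: (@fatou_le _ _ _ mu (fun n x => cmod (g n x))).
  - by move=> n; exact: nnegmf_cmod.
  - exact: nnegmf_cmod.
  - apply: aeW => x; apply: cvg_near_cst.
    exists (Num.truncn (cmod (f x))).+1 => // n /= nf; rewrite gE min_l//.
    by rewrite (le_trans (ltW (truncnS_gt _)))// ler_nat.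
  - by move=> n; rewrite leeBrDl//; exact: Hn.
rewrite -(fineK fin) -EFinB lee_fin; move: (fine _) => r; lra.
Qed.

Section bounded_weights.
Variables (beta : nat -> R[i]) (C : R).
Hypotheses (C0 : 0 < C) (betaC : forall k, cmod (beta k) <= C).

Lemma cmod_weighted_avg_bounded f n x : cmod (weighted_avg beta T f n x) <=
  C * (n%:R^-1 * \sum_(k < n) cmod (iter k T f x)).
Proof.
rewrite (le_trans (cmod_weighted_avg _ _ _ _))// mulrCA ler_wpM2l ?invr_ge0//.
by rewrite mulr_sumr ler_sum// => k _; rewrite ler_wpM2r// cmod_ge0.
Qed.

Lemma weighted_avgB f g : L1_plus_Loo mu f -> L1_plus_Loo mu g ->
  \forall x \ae mu, forall n, weighted_avg beta T f n x - weighted_avg beta T g n x =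
    weighted_avg beta T (fun x => f x - g x) n x.
Proof.
move=> xf xg.
have : \forall x \ae mu, forall k,
    iter k T (fun x => f x - g x) x = iter k T f x - iter k T g x.
  by apply: ae_foralln => k; exact: (dsB (ds_iter k hT)).
apply: filterS => x H n; rewrite /weighted_avg -mulrBr -sumrB; congr (_ * _).
by apply: eq_bigr => k _; rewrite H mulrBr.
Qed.

Lemma weighted_avg_bnd f c : 0 <= c -> cmeasurable f ->
  (\forall x \ae mu, cmod (f x) <= c) ->
  \forall x \ae mu, forall n, cmod (weighted_avg beta T f n x) <= C * c.
Proof.
move=> c0 mf fc.
have fk : \forall x \ae mu, forall k, cmod (iter k T f x) <= c.
  by apply: ae_foralln => k; exact: (ds_bnd (ds_iter k hT)).
apply: filterS fk => x fk n; rewrite (le_trans (cmod_weighted_avg_bounded _ _ _))//.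
rewrite ler_wpM2l ?(ltW C0)//.
apply: (@le_trans _ _ (n%:R^-1 * \sum_(k < n) c)).
  by rewrite ler_wpM2l ?invr_ge0// ler_sum.
rewrite sumr_const card_ord -[c *+ n]mulr_natl mulrA.
have [->|n0] := posnP n; first by rewrite mulr0 mul0r.
by rewrite mulVf ?mul1r// pnatr_eq0 -lt0n.
Qed.

Lemma weighted_avg_cLp1 f n : cLp mu 1%E f ->
  cmeasurable (weighted_avg beta T f n) /\
  (L1n mu (weighted_avg beta T f n) <= C%:E * L1n mu f)%E.
Proof.
move=> f1; have k1 k := ds_cLp1 (ds_iter k hT) f1.
have mk k : cmeasurable (iter k T f) by have /cLp1P[] := k1 k.
have mw : cmeasurable (weighted_avg beta T f n).
  by apply/cmeasZ/cmeas_sum => k; exact: cmeasZ.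
split=> //; have n0 : 0 <= n%:R^-1 :> R by rewrite invr_ge0.
have nk (k : 'I_n) := nnegmfZ n0 (nnegmf_cmod (mk k)).
have ns := nnegmf_sum nk.
apply: (@le_trans _ _ (integ mu (fun x => C * \sum_(k < n) n%:R^-1 * cmod (iter k T f x)))).
  apply: le_integ; [exact: nnegmf_cmod|exact: (nnegmfZ (ltW C0) ns)|].
  by apply: aeW => x; rewrite -mulr_sumr cmod_weighted_avg_bounded.
rewrite (integZ mu (ltW C0) ns) lee_pmul2l// (integ_sum mu nk).
apply: (@le_trans _ _ (\sum_(k < n) (n%:R^-1)%:E * L1n mu f)%E).
  apply: lee_sum => k _; rewrite (integZ mu n0 (nnegmf_cmod (mk k))).
  by apply: lee_wpmul2l => //; exact: (ds_L1n (ds_iter k hT) f1).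
have [_ f1y] := iffLR (cLp1P mu _) f1.
have fin : L1n mu f \is a fin_num by rewrite ge0_fin_numE// L1n_ge0.
rewrite -(fineK fin); under eq_bigr do rewrite -EFinM.
rewrite sumEFin lee_fin sumr_const card_ord -[leLHS]mulr_natr mulrAC.
have [->|n1] := posnP n; first by rewrite mulr0 mul0r fine_ge0// L1n_ge0.
by rewrite mulVf ?mul1r// pnatr_eq0 -lt0n.
Qed.

Hypothesis hb : bounded_besicovitch beta.

(** The maximal inequality makes all averages of the small tail small off a
    small set. *)
Lemma au_cauchy_L1 f : cLp mu 1%E f -> au_cauchy mu (weighted_avg beta T f).
Proof.
move=> f1; apply: au_cauchy_closed => e e0.
have lam0 : 0 < e / C by rewrite divr_gt0.
have el : 0 < e * (e / C) by rewrite mulr_gt0.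
have [g [vg fg1 fge]] := L1_truncation f1 el.
exists (weighted_avg beta T g); split; first exact: au_cauchy_L1Loo.
have := weak_type11 hT fg1 lam0; set A := \bigcup_n _ => muA.
apply: (@au_close_bad _ _ _ _ _ _ _ A) => //.
- apply: bigcup_measurable => n _; apply: measurable_avg_gt => k.
  by have /cLp1P[] := ds_cLp1 (ds_iter k hT) fg1.
- by move: (le_trans muA fge); rewrite [(e * (e / C))%:E]EFinM muleC lee_pmul2r.
- move=> n n0; apply: filterS (weighted_avgB (L1_Lsum f1) (L1Loo_Lsum vg)) => x -> xA.
  rewrite (le_trans (cmod_weighted_avg_bounded _ _ _))// -ler_pdivlMl// mulrC ler_pdivrMr ?ltr0n//.
  rewrite mulrC [_^-1 * e]mulrC leNgt; apply/negP => xn; apply: xA.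
  by exists n.
Qed.

(** The truncation at height [e] is removed; the rest lives on a set of finite
    measure, where the bounded summand of [f] is integrable. *)
Lemma Rmu_split f e : Rmu mu f -> 0 < e ->
  exists a, cLp mu 1%E a /\ forall x, cmod (f x - a x) <= e.
Proof.
move=> [xf fe] e0; have mf := Lsum_meas xf.
pose t x := trunc e (f x).
have mt : cmeasurable t by apply: cmeas_trunc => //; exact: measurable_cst.
exists (fun x => f x - t x); split; last first.
  by move=> x; rewrite opprB addrC subrK cmod_trunc ?(ltW e0)// ge_min lexx orbT.
have [g [h [/cLp1P[mg g1] /cLpooP[mh [M [M0 hM]]] fgh]]] := xf.
pose A := [set x | e < cmod (f x)].
have mA : measurable A.
  by apply: measurable_ltr_set; [exact: measurable_cst|exact: cmeas_cmod].
have ng := nnegmf_cmod mg; have nA := nnegmfZ M0 (nnegmf_indic R mA).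
apply/cLp1P; split; first exact: cmeasB.
apply: (@le_lt_trans _ _ (integ mu (fun x => cmod (g x) + M * \1_A x))).
  apply: le_integ; [by apply: nnegmf_cmod; exact: cmeasB|exact: nnegmfD|].
  apply: filterS hM => x hM; rewrite cmod_trunc_res ?(ltW e0)// cmod_trunc ?(ltW e0)//.
  rewrite indicE; have [fx|fx] := leP (cmod (f x)) e.
    by rewrite subrr addr_ge0 ?cmod_ge0// mulr_ge0.
  rewrite mem_set// mulr1 (le_trans (_ : _ <= cmod (f x)))//; first by rewrite gerBl ltW.
  by rewrite fgh (le_trans (cmodD _ _))// lerD2l.
rewrite (integD mu ng nA) (integZ mu M0 (nnegmf_indic R mA)) integ_indic//.
by apply: lte_add_pinfty => //; apply: lte_mul_pinfty => //; exact: fe.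
Qed.

Lemma au_cauchy_Rmu f : Rmu mu f -> au_cauchy mu (weighted_avg beta T f).
Proof.
move=> rf; apply: au_cauchy_closed => e e0.
have eC : 0 < e / C by rewrite divr_gt0.
have [a [a1 fa]] := Rmu_split rf eC.
exists (weighted_avg beta T a); split; first exact: au_cauchy_L1.
have xf := rf.1; have xa := L1_Lsum a1.
apply: (@au_close_ae _ _ _ _ _ _ _ 0%N) => // n _.
have mB : cmeasurable (fun x => f x - a x) := cmeasB (Lsum_meas xf) (Lsum_meas xa).
have := weighted_avg_bnd (ltW eC) mB (aeW _ fa).
apply: filterS2 (weighted_avgB xf xa) => x -> /(_ n).
by rewrite mulrCA divff ?mulr1// lt0r_neq0.
Qed.

End bounded_weights.

End besicovitch.

(** * Completeness for almost uniform convergence *)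

Section completeness.
Context d (Omega : measurableType d) (R : realType).
Variable mu : {measure set Omega -> \bar R}.
Implicit Types (F : nat -> Omega -> R[i]) (f g : Omega -> R[i]) (e : R).

Let half j : R := 2^-1 ^+ j.

Lemma half_gt0 j : 0 < half j.
Proof. by rewrite exprn_gt0// invr_gt0. Qed.

Lemma half_S j : half j.+1 = half j / 2.
Proof. by rewrite /half exprSr. Qed.

Lemma half_small e : 0 < e -> exists J, forall j, (J <= j)%N -> half j <= e.
Proof.
move=> e0; have : half j @[j --> \oo] --> (0 : R).
  by apply: cvg_expr; rewrite ger0_norm// invf_lt1// ltr1n.
move=> /cvgr0Pnorm_le /(_ _ e0)[J _ HJ]; exists J => j Jj.
by have := HJ j Jj; rewrite gtr0_norm// half_gt0.
Qed.

Lemma mu_bigcup_half (E : nat -> set Omega) e : 0 <= e ->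
  (forall j, measurable (E j)) ->
  (forall j, (mu (E j) <= (e * half j.+1)%:E)%E) ->
  (mu (\bigcup_j E j) <= e%:E)%E.
Proof.
move=> e0 mE Ee.
have -> : \bigcup_j E j = \bigcup_N \big[setU/set0]_(j < N) E j.
  apply/seteqP; split=> x.
    by move=> [j _ xj]; exists j.+1 => //; rewrite -bigcup_mkord; exists j => /=.
  by move=> [N _]; rewrite -bigcup_mkord => -[j _ xj]; exists j.
apply: nondecreasing_mu_le => [N|N x|N].
- exact: bigsetU_measurable.
- by rewrite big_ord_recr /=; left.
apply: (@le_trans _ _ (e * (1 - half N))%:E); last first.
  by rewrite lee_fin ler_piMr// gerBl ltW// half_gt0.
elim: N => [|N IH].
  by rewrite big_ord0 measure0 /half expr0 subrr mulr0.
rewrite big_ord_recr/=; apply: le_trans (leU_mu mu _ _) _ => //.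
  exact: bigsetU_measurable.
apply: le_trans (leeD IH (Ee N)) _; rewrite -EFinD lee_fin half_S.
by rewrite le_eqVlt; apply/orP; left; apply/eqP; field.
Qed.

(** The tolerances [eps / 2 ^ (j + 1)] have exceptional sets whose measures sum to
    at most [eps]; the union works for every tolerance. *)
Lemma au_close_uniform F f eps : (forall e, 0 < e -> au_close mu e F (fun=> f)) ->
  0 < eps -> exists E, [/\ measurable E, (mu E <= eps%:E)%E & forall e, 0 < e ->
    exists N, forall n, (N <= n)%N -> forall x, ~ E x -> cmod (F n x - f x) <= e].
Proof.
move=> H eps0; have ej j : 0 < eps * half j.+1 by rewrite mulr_gt0// half_gt0.
have /choice[E HE] : forall j, exists E : set Omega, [/\ measurable E,
    (mu E <= (eps * half j.+1)%:E)%E & exists N, forall n, (N <= n)%N ->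
    forall x, ~ E x -> cmod (F n x - f x) <= eps * half j.+1].
  by move=> j; exact: H (ej j).
exists (\bigcup_j E j); split.
- by apply: bigcup_measurable => j _; have [] := HE j.
- apply: mu_bigcup_half => [|j|j]; first exact: ltW.
    by have [] := HE j.
  by have [] := HE j.
- move=> e e0; have [J HJ] := half_small (divr_gt0 e0 eps0).
  have [_ _ [N HN]] := HE J; exists N => n Nn x xE.
  apply: (@le_trans _ _ (eps * half J.+1)).
    by apply: HN => // xJ; apply: xE; exists J.
  by rewrite mulrC -ler_pdivlMr// HJ// leqnSn.
Qed.

Lemma au_close_cvg_ae F f : (forall e, 0 < e -> au_close mu e F (fun=> f)) ->
  \forall x \ae mu, forall e, 0 < e -> exists N, forall n, (N <= n)%N ->
    cmod (F n x - f x) <= e.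
Proof.
move=> H.
have /choice[E HE] := fun j => au_close_uniform H (half_gt0 j).
exists (\bigcap_j E j); split.
- by apply: bigcap_measurable => // j _; have [] := HE j.
- apply/eqP; rewrite eq_le measure_ge0 andbT; apply/lee_addgt0Pr => e e0.
  rewrite add0e; have [J HJ] := half_small e0; have [mE Ee _] := HE J.
  apply: (@le_trans _ _ (mu (E J))).
    apply: le_measure; rewrite ?inE//; last by move=> x; apply.
    by apply: bigcap_measurable => // j _; have [] := HE j.
  by apply: le_trans Ee _; rewrite lee_fin HJ.
- move=> x /= nx j _; apply: contrapT => xE; apply: nx => e e0.
  by have [_ _ /(_ _ e0)[N HN]] := HE j; exists N => n Nn; exact: HN.
Qed.

Lemma au_close_au_cvg F f : (forall e, 0 < e -> au_close mu e F (fun=> f)) ->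
  au_cvg mu F f.
Proof.
move=> H eps eps0; have [E [mE Ee HE]] := au_close_uniform H eps0.
exists (~` E); split; [exact: measurableC|by rewrite setCK|].
have bnd e : 0 < e -> exists N, forall n, (N <= n)%N ->
    (cLnorm mu +oo (fun x => (f x - F n x) * \1_(~` E) x)%R <= e%:E)%E.
  move=> e0; have [N HN] := HE e e0; exists N => n Nn.
  apply/cLnormooP; first exact: ltW.
  apply: aeW => x; rewrite indicE cmodM cmod_nat.
  have [xE|xE] := boolP (x \in ~` E); last by rewrite mulr0 ltW.
  by rewrite mulr1 cmodBC HN//; move: xE; rewrite inE.
have ge0 n : (0 <= cLnorm mu +oo (fun x => (f x - F n x) * \1_(~` E) x)%R)%E.
  exact: Lnorm_ge0.
apply/fine_cvgP; split.
  have [N HN] := bnd 1 ltr01; exists N => // n Nn.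
  by rewrite ge0_fin_numE//; apply: le_lt_trans (HN n Nn) (ltry _).
apply/cvgr0Pnorm_le => e e0; have [N HN] := bnd e e0; exists N => // n Nn /=.
rewrite ger0_norm ?fine_ge0// -lee_fin fineK; first exact: HN.
by rewrite ge0_fin_numE//; apply: le_lt_trans (HN n Nn) (ltry _).
Qed.

Lemma cvg_half (u : nat -> R) J :
  (forall i j, (J <= i)%N -> (i <= j)%N -> `|u i - u j| <= half i) -> cvgn u.
Proof.
move=> uJ; apply/cauchy_cvgP/cauchy_exP => e e0.
have e2 : 0 < e / 2 by rewrite divr_gt0.
have [K HK] := half_small e2; exists (u (maxn J K)); exists (maxn J K) => // j /= Jj.
rewrite /ball/= (le_lt_trans (uJ _ _ (leq_maxl _ _) Jj))//.
rewrite (le_lt_trans (HK _ (leq_maxr _ _)))//.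
by rewrite ltr_pdivrMr// ltr_pMr// ltr1n.
Qed.

Lemma limn_dist (u : nat -> R) i (c : R) : cvgn u ->
  (forall j, (i <= j)%N -> `|u i - u j| <= c) -> `|u i - limn u| <= c.
Proof.
move=> cu uc.
have h j : (i <= j)%N -> u i - c <= u j <= u i + c.
  by move=> /uc; rewrite distrC ler_distl.
rewrite distrC ler_distl; apply/andP; split.
  by apply: limr_ge => //; exists i => // j /= /h/andP[].
by apply: limr_le => //; exists i => // j /= /h/andP[].
Qed.

(** The constant sequences [g j] that approximate [F] within [2 ^ - (j + 1)] are
    compared through [F]: off the union [W J] of the exceptional sets from [J] on
    they form a Cauchy sequence with an explicit rate. Multiplying by the
    indicator of the set [G] of good points makes the convergence hold
    everywhere, which gives a measurable limit. *)
Theorem au_cauchy_limit F : au_cauchy mu F ->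
  exists f, cmeasurable f /\ forall e, 0 < e -> au_close mu e F (fun=> f).
Proof.
move=> cF.
have /choice[g Hg] := fun j => cF _ (half_gt0 j.+1).
have mg j : cmeasurable (g j) := (Hg j).1.
have /choice[E HE] := fun j => (Hg j).2.
have mE j : measurable (E j) by have [] := HE j.
pose W J := \bigcup_j E (J + j)%N.
have mW J : measurable (W J) by exact: bigcup_measurable.
have muW J : (mu (W J) <= (half J)%:E)%E.
  apply: mu_bigcup_half => [|j //|j]; first exact/ltW/half_gt0.
  have [_ Ej _] := HE (J + j)%N; apply: le_trans Ej _.
  by rewrite lee_fin /half -exprD addnS.
have nW J x : ~ W J x -> forall j, (J <= j)%N -> ~ E j x.
  by move=> xW j Jj xE; apply: xW; exists (j - J)%N => //=; rewrite subnKC.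
have gg J x : ~ W J x -> forall i j, (J <= i)%N -> (i <= j)%N ->
    cmod (g i x - g j x) <= half i.
  move=> xW i j Ji ij; have Jj := leq_trans Ji ij.
  have [_ _ [N HN]] := HE i; have [_ _ [N' HN']] := HE j.
  have h1 := HN (maxn N N') (leq_maxl _ _) x (nW _ _ xW _ Ji).
  have h2 := HN' (maxn N N') (leq_maxr _ _) x (nW _ _ xW _ Jj).
  set z := F _ x in h1 h2.
  rewrite -[g i x - g j x](_ : z - g j x - (z - g i x) = _); last by ring.
  rewrite (le_trans (cmodB _ _))//.
  have hj : half j.+1 <= half i.+1.
    by rewrite ler_wiXn2l ?invr_ge0// invf_le1// ler1n.
  have := half_S i; move: h1 h2 hj; rewrite -/(half i.+1); lra.
pose G := \bigcup_J ~` W J.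
have mG : measurable G by apply: bigcup_measurable => J _; exact: measurableC.
pose gr j x : R := \1_G x * complex.Re (g j x).
pose gi j x : R := \1_G x * complex.Im (g j x).
have distr J x : ~ W J x -> forall i j, (J <= i)%N -> (i <= j)%N ->
    `|gr i x - gr j x| <= half i /\ `|gi i x - gi j x| <= half i.
  move=> xW i j Ji ij; have xG : G x by exists J.
  rewrite /gr /gi indicE mem_set// !mul1r.
  have ReB (z w : R[i]) : complex.Re z - complex.Re w = complex.Re (z - w).
    by case: z w => ? ? [].
  have ImB (z w : R[i]) : complex.Im z - complex.Im w = complex.Im (z - w).
    by case: z w => ? ? [].
  rewrite ReB ImB; split; apply: le_trans (gg _ _ xW _ _ Ji ij).
    exact: normRe_le_cmod.
  exact: normIm_le_cmod.
have cvg_ x : cvgn (gr ^~ x) /\ cvgn (gi ^~ x).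
  have [[J _ xW]|nG] := pselect (G x); last first.
    have z (u : nat -> R) : (forall j, u j = 0) -> cvgn u.
      by move=> u0; apply/cvg_ex; exists 0; apply: cvg_near_cst; exact: nearW.
    by split; apply: z => j; rewrite /gr /gi indicE memNset// mul0r.
  split; apply: (@cvg_half _ J) => i j Ji ij.
    exact: (distr _ _ xW _ _ Ji ij).1.
  exact: (distr _ _ xW _ _ Ji ij).2.
pose f x : R[i] := Complex (limn (gr ^~ x)) (limn (gi ^~ x)).
have mf : cmeasurable f.
  split=> /=.
    apply: (@measurable_fun_cvg _ _ _ _ gr); last by move=> x _; exact: (cvg_ x).1.
    by move=> j; apply: measurable_funM; [exact: measurable_indic|exact: (mg j).1].
  apply: (@measurable_fun_cvg _ _ _ _ gi); last by move=> x _; exact: (cvg_ x).2.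
  by move=> j; apply: measurable_funM; [exact: measurable_indic|exact: (mg j).2].
have gf J x : ~ W J x -> cmod (g J x - f x) <= 2 * half J.
  move=> xW; have xG : G x by exists J.
  rewrite (le_trans (cmod_le_ReIm _))// mulr_natl mulr2n.
  have ReE : complex.Re (g J x - f x) = gr J x - limn (gr ^~ x).
    have -> : gr J x = complex.Re (g J x) by rewrite /gr indicE mem_set// mul1r.
    by case: (g J x).
  have ImE : complex.Im (g J x - f x) = gi J x - limn (gi ^~ x).
    have -> : gi J x = complex.Im (g J x) by rewrite /gi indicE mem_set// mul1r.
    by case: (g J x).
  rewrite ReE ImE lerD//.
    by apply: (@limn_dist (gr ^~ x)); [exact: (cvg_ x).1|move=> j Jj; exact: (distr _ _ xW _ _ _ Jj).1].
  by apply: (@limn_dist (gi ^~ x)); [exact: (cvg_ x).2|move=> j Jj; exact: (distr _ _ xW _ _ _ Jj).2].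
exists f; split=> // e e0; have e3 : 0 < e / 3 by rewrite divr_gt0.
have [J HJ] := half_small e3; have hJ := HJ J (leqnn _); have hp := half_gt0 J.
exists (W J); split=> //.
  by apply: le_trans (muW J) _; rewrite lee_fin; lra.
have [_ _ [N HN]] := HE J; exists N => n Nn x xW.
have h1 := HN n Nn x (nW _ _ xW _ (leqnn _)); have h2 := gf _ _ xW.
rewrite -[F n x](subrK (g J x)) -addrA (le_trans (cmodD _ _))//.
move: h1; rewrite -/(half J.+1) half_S; lra.
Qed.

End completeness.

(** * The limit *)

Section limit.
Context d (Omega : measurableType d) (R : realType).
Variable mu : {measure set Omega -> \bar R}.
Variable T : (Omega -> R[i]) -> Omega -> R[i].
Hypothesis hT : dunford_schwartz mu T.
Variables (beta : nat -> R[i]) (C : R).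
Hypotheses (C0 : 0 < C) (betaC : forall k, cmod (beta k) <= C).

Lemma limit_cLp1 a ahat : cLp mu 1%E a -> cmeasurable ahat ->
  (forall e, 0 < e -> au_close mu e (weighted_avg beta T a) (fun=> ahat)) ->
  cLp mu 1%E ahat.
Proof.
move=> a1 mah cl; apply/cLp1P; split=> //.
have wa n := weighted_avg_cLp1 hT C0 betaC n a1.
have [_ a1y] := iffLR (cLp1P mu _) a1.
apply: (@le_lt_trans _ _ (C%:E * L1n mu a)%E); last first.
  by apply: lte_mul_pinfty => //; rewrite lee_fin ltW.
apply: (@fatou_le _ _ _ mu (fun n x => cmod (weighted_avg beta T a n x))).
- by move=> n; apply: nnegmf_cmod; exact: (wa n).1.
- exact: nnegmf_cmod.
- apply: filterS (au_close_cvg_ae cl) => x cx; apply/cvgrPdist_le => e e0.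
  have [N HN] := cx e e0; exists N => // n Nn; apply: le_trans (HN n Nn).
  exact: cmod_dist.
- by move=> n; exact: (wa n).2.
Qed.

(** Splitting off an [L^1] part [a] with [f - a] uniformly small splits the limit in
    the same way: the limit for [a] is in [L^1] by Fatou, and the averages of
    [f - a] are uniformly small. This gives both the decomposition of the limit
    and the finiteness of its level sets. *)
Lemma limit_Rmu f fhat : bounded_besicovitch beta -> Rmu mu f -> cmeasurable fhat ->
  (forall e, 0 < e -> au_close mu e (weighted_avg beta T f) (fun=> fhat)) ->
  Rmu mu fhat.
Proof.
move=> hb rf mfh clf.
have split_ (e : R) : 0 < e -> exists ahat, cLp mu 1%E ahat /\
    \forall x \ae mu, cmod (fhat x - ahat x) <= e.
  move=> e0; have eC : 0 < e / 2 / C by rewrite !divr_gt0.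
  have [a [a1 fa]] := Rmu_split rf eC.
  have [ahat [mah cla]] := au_cauchy_limit (au_cauchy_L1 hT C0 betaC hb a1).
  exists ahat; split; first exact: limit_cLp1 cla.
  have xf := rf.1; have xa := L1_Lsum a1.
  have mB := cmeasB (Lsum_meas xf) (Lsum_meas xa).
  have wb := weighted_avg_bnd hT C0 betaC (ltW eC) mB (aeW _ fa).
  have wB := weighted_avgB hT beta xf xa.
  apply: filterS3 (filterI wb wB) (au_close_cvg_ae clf) (au_close_cvg_ae cla).
  move=> x [wb' wB'] cf ca.
  have e4 : 0 < e / 4 by rewrite divr_gt0.
  have [N HN] := cf _ e4; have [N' HN'] := ca _ e4.
  have h1 := HN _ (leq_maxl N N'); have h2 := HN' _ (leq_maxr N N').
  have h3 := wb' (maxn N N'); rewrite -wB' in h3.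
  move: h1 h2 h3; set F := weighted_avg _ _ f _ x; set A := weighted_avg _ _ a _ x.
  move=> h1 h2 h3.
  have -> : fhat x - ahat x = (F - A) - (F - fhat x) + (A - ahat x) by ring.
  have := cmodD (F - A - (F - fhat x)) (A - ahat x).
  have := cmodB (F - A) (F - fhat x).
  have Ce : C * (e / 2 / C) = e / 2 by rewrite mulrCA divff ?mulr1// lt0r_neq0.
  rewrite Ce in h3.
  lra.
split.
  have [ahat [a1 fa]] := split_ 1 ltr01; have [ma _] := iffLR (cLp1P mu _) a1.
  exists ahat, (fun x => fhat x - ahat x); split=> //; last first.
    by apply/funext => x; rewrite addrC subrK.
  by apply/cLpooP; split; [exact: cmeasB|exists 1].
move=> lam lam0; have lam2 : 0 < lam / 2 by rewrite divr_gt0.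
have [ahat [a1 fa]] := split_ _ lam2; have [ma a1y] := iffLR (cLp1P mu _) a1.
apply: (@le_lt_trans _ _ (mu [set x | (lam / 2 <= cmod (ahat x))%R])).
  apply: ae_le_mu.
  - by apply: measurable_ltr_set; [exact: measurable_cst|exact: cmeas_cmod].
  - by apply: measurable_ler_set; [exact: measurable_cst|exact: cmeas_cmod].
  apply: filterS fa => x /= fa fx.
  have := cmodD (fhat x - ahat x) (ahat x); rewrite subrK; lra.
have := markov_integ mu lam2 (nnegmf_cmod ma).
rewrite muleC -lee_pdivlMr// => /le_lt_trans; apply.
by rewrite muleC; apply: lte_mul_pinfty => //; rewrite lee_fin invr_ge0 ltW.
Qed.

End limit.

Theorem theorem4p4 (R : realType) (d : measure_display)
    (Omega : measurableType d)
    (mu : {sigma_finite_measure set Omega -> \bar R})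
    (T : (Omega -> R[i]) -> (Omega -> R[i]))
    (hT : dunford_schwartz mu T)
    (beta : nat -> R[i]) (hbeta : bounded_besicovitch beta)
    (f : Omega -> R[i]) (hf : Rmu mu f) :
  exists fhat : Omega -> R[i],
    Rmu mu fhat /\ au_cvg mu (weighted_avg beta T f) fhat.
Proof.
have [[C0 betaC0] _] := hbeta.
have C_gt0 : 0 < `|C0| + 1 by rewrite ltr_wpDl.
have betaC k : cmod (beta k) <= `|C0| + 1.
  by rewrite (le_trans (betaC0 k))// (le_trans (ler_norm _))// lerDl.
have [fhat [mfhat cl]] := au_cauchy_limit (au_cauchy_Rmu hT C_gt0 betaC hbeta hf).
exists fhat; split; last exact: au_close_au_cvg.
exact: (limit_Rmu hT C_gt0 betaC hbeta hf mfhat cl).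
Qed.
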